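(* The following is provable in $\mathrm{ACA}_0$. Let $L$ be a countable algebraic distributive lattice. Then the set $\{a\in L\mid a\text{ is compact}\}$ has the $\Pi^0_3(L)$ form $$\{a\in L\mid (\forall x<a)(\exists b)(x\le b\sqsubset a)\};$$ that is, for every $a\in L$, $a$ is compact if and only if for every $x\in L$ with $x<a$ there is $b\in L$ with $x\le b$ and $b\sqsubset a$.
   Context: $\mathrm{ACA}_0$ is the subsystem of second order arithmetic with arithmetical comprehension. Here $\le$ and $<$ denote the (strict) lattice order of $L$. We write $b\sqsubset a$ (''$b$ is a coatom relative to $a$'') if $b<a$ and there is no $y\in L$ with $b<y<a$. A lattice is complete if every subset has both a supremum and an infimum. An element $a\in L$ is compact if for each subset $S\subseteq L$, if $a\le\sup S$ then there is a finite subset $S'\subseteq S$ such that $a\le\sup S'$. A lattice is compactly generated if every element is the supremum of a set of compact elements, and algebraic if it is complete and compactly generated. In second order arithmetic the underlying set of a countable lattice is a subset of $\mathbb{N}$ and quantification over subsets of $L$ is set quantification. $\Pi^0_3(L)$ means definable by a $\Pi^0_3$ formula with the lattice $L$ as a set parameter. *)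

(* Defs.v *)
(* Uses only the Rocq standard library. *)
From Stdlib Require Import List.
Import ListNotations.

(* Second order arithmetic has two sorts of variables, numbers and sets, each with
   its own de Bruijn indexing: a number quantifier leaves set indices unchanged
   and conversely. *)

Inductive term : Type :=
| Var (n : nat)
| Zero
| One
| Add (s t : term)
| Mul (s t : term).

(* The logic is classical, so the remaining connectives and the existential
   quantifiers are abbreviations. *)
Inductive form : Type :=
| Eq (s t : term)
| Lt (s t : term)
| In (t : term) (X : nat)
| Bot
| Imp (A B : form)
| AllN (A : form)
| AllS (A : form).

Definition Not (A : form) : form := Imp A Bot.
Definition And (A B : form) : form := Not (Imp A (Not B)).
Definition Or (A B : form) : form := Imp (Not A) B.
Definition Iff (A B : form) : form := And (Imp A B) (Imp B A).
Definition ExN (A : form) : form := Not (AllN (Not A)).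
Definition ExS (A : form) : form := Not (AllS (Not A)).

Declare Scope soa_scope.
Delimit Scope soa_scope with soa.
Bind Scope soa_scope with form.

Notation "# n" := (Var n) (at level 1, format "# n") : soa_scope.
Notation "s ≐ t" := (Eq s t) (at level 70, no associativity) : soa_scope.
Notation "s ≺ t" := (Lt s t) (at level 70, no associativity) : soa_scope.
Notation "t ∈ X" := (In t X) (at level 70, no associativity) : soa_scope.
Notation "A ∧ B" := (And A B) (at level 80, right associativity) : soa_scope.
Notation "A ∨ B" := (Or A B) (at level 85, right associativity) : soa_scope.
Notation "A ⇒ B" := (Imp A B) (at level 90, right associativity) : soa_scope.
Notation "A ⇔ B" := (Iff A B) (at level 95, no associativity) : soa_scope.

Local Open Scope soa_scope.

Fixpoint substT (f : nat -> term) (t : term) : term :=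
  match t with
  | Var n => f n
  | Zero => Zero
  | One => One
  | Add s t => Add (substT f s) (substT f t)
  | Mul s t => Mul (substT f s) (substT f t)
  end.

Definition liftT (t : term) : term := substT (fun n => Var (S n)) t.
Notation "↑ t" := (liftT t) (at level 1, t at level 1, format "↑ t") : soa_scope.

Definition scons {T : Type} (x : T) (f : nat -> T) (n : nat) : T :=
  match n with
  | O => x
  | S m => f m
  end.

(* Capture-avoiding parallel substitution: terms for the number variables, set
   variables for the set variables (the language has no compound set terms). *)
Fixpoint subst (f : nat -> term) (g : nat -> nat) (A : form) : form :=
  match A with
  | Eq s t => Eq (substT f s) (substT f t)
  | Lt s t => Lt (substT f s) (substT f t)
  | In t X => In (substT f t) (g X)
  | Bot => Bot
  | Imp A B => Imp (subst f g A) (subst f g B)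
  | AllN A => AllN (subst (scons (Var 0) (fun n => liftT (f n))) g A)
  | AllS A => AllS (subst f (scons 0 (fun n => S (g n))) A)
  end.

Definition shiftN (A : form) : form := subst (fun n => Var (S n)) (fun X => X) A.
Definition shiftS (A : form) : form := subst Var S A.
Definition instN (t : term) (A : form) : form := subst (scons t Var) (fun X => X) A.
Definition instS (X : nat) (A : form) : form := subst Var (scons X (fun Y => Y)) A.

(* Natural deduction for two-sorted classical logic with equality on numbers.
   The eigenvariable conditions concern only the hypotheses [G]: a member of
   [T] with free variables therefore stands for its universal closure. *)

Inductive prv (T : form -> Prop) : list form -> form -> Prop :=
| prv_ax G A : T A -> prv T G A
| prv_hyp G A : List.In A G -> prv T G A
| prv_impI G A B : prv T (A :: G) B -> prv T G (A ⇒ B)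
| prv_impE G A B : prv T G (A ⇒ B) -> prv T G A -> prv T G B
| prv_raa G A : prv T (Not A :: G) Bot -> prv T G A
| prv_allNI G A : prv T (map shiftN G) A -> prv T G (AllN A)
| prv_allNE G A t : prv T G (AllN A) -> prv T G (instN t A)
| prv_allSI G A : prv T (map shiftS G) A -> prv T G (AllS A)
| prv_allSE G A X : prv T G (AllS A) -> prv T G (instS X A)
| prv_refl G t : prv T G (t ≐ t)
| prv_leibniz G A s t :
    prv T G (s ≐ t) -> prv T G (instN s A) -> prv T G (instN t A).

Definition provable (T : form -> Prop) (A : form) : Prop := prv T [] A.

Fixpoint arithmetical (A : form) : Prop :=
  match A with
  | Eq _ _ | Lt _ _ | In _ _ | Bot => True
  | Imp A B => arithmetical A /\ arithmetical B
  | AllN A => arithmetical A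
  | AllS _ => False
  end.

Inductive ACA0 : form -> Prop :=
| aca_succ_nonzero : ACA0 (AllN (Not (Add #0 One ≐ Zero)))
| aca_succ_inj :
    ACA0 (AllN (AllN (Add #1 One ≐ Add #0 One ⇒ #1 ≐ #0)))
| aca_add_zero : ACA0 (AllN (Add #0 Zero ≐ #0))
| aca_add_succ :
    ACA0 (AllN (AllN (Add #1 (Add #0 One) ≐ Add (Add #1 #0) One)))
| aca_mul_zero : ACA0 (AllN (Mul #0 Zero ≐ Zero))
| aca_mul_succ :
    ACA0 (AllN (AllN (Mul #1 (Add #0 One) ≐ Add (Mul #1 #0) #1)))
| aca_lt_zero : ACA0 (AllN (Not (#0 ≺ Zero)))
| aca_lt_succ :
    ACA0 (AllN (AllN (#1 ≺ Add #0 One ⇔ #1 ≺ #0 ∨ #1 ≐ #0)))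
| aca_induction :
    ACA0 (AllS ((Zero ∈ 0 ∧ AllN (#0 ∈ 0 ⇒ Add #0 One ∈ 0)) ⇒ AllN (#0 ∈ 0)))
(* [A] may contain further free number and set variables as parameters;
   [shiftS] ensures that the set being defined is not one of them. *)
| aca_comprehension A :
    arithmetical A -> ACA0 (ExS (AllN (#0 ∈ 0 ⇔ shiftS A))).

Inductive bounded : form -> Prop :=
| bounded_eq s t : bounded (s ≐ t)
| bounded_lt s t : bounded (s ≺ t)
| bounded_in t X : bounded (t ∈ X)
| bounded_bot : bounded Bot
| bounded_imp A B : bounded A -> bounded B -> bounded (A ⇒ B)
| bounded_all t A : bounded A -> bounded (AllN (#0 ≺ ↑t ⇒ A))
| bounded_ex t A : bounded A -> bounded (ExN (#0 ≺ ↑t ∧ A)).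

Definition Pi03 (A : form) : Prop :=
  exists B : form, bounded B /\ A = AllN (ExN (AllN B)).

Fixpoint vars_belowT (n : nat) (t : term) : Prop :=
  match t with
  | Var i => i < n
  | Zero | One => True
  | Add s t | Mul s t => vars_belowT n s /\ vars_belowT n t
  end.

Fixpoint vars_below (n k : nat) (A : form) : Prop :=
  match A with
  | Eq s t | Lt s t => vars_belowT n s /\ vars_belowT n t
  | In t X => vars_belowT n t /\ X < k
  | Bot => True
  | Imp A B => vars_below n k A /\ vars_below n k B
  | AllN A => vars_below (S n) k A
  | AllS A => vars_below n (S k) A
  end.

(* A countable lattice is a pair of sets: [L], the carrier, and [R], the codes
   of the pairs (x, y) with x ≤ y.  Throughout, [L], [R], [D], [E] are set
   variables and have to be incremented below [AllS] and [ExS]; number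
   arguments are terms and have to be lifted below [AllN] and [ExN]. *)

(* (i, j) is coded by (i + j)^2 + i, which is injective on pairs. *)
Definition pair (s t : term) : term := Add (Mul (Add s t) (Add s t)) s.

Definition allIn (L : nat) (A : form) : form := AllN (#0 ∈ L ⇒ A).
Definition exIn (L : nat) (A : form) : form := ExN (#0 ∈ L ∧ A).

Definition subset (D E : nat) : form := AllN (#0 ∈ D ⇒ #0 ∈ E).

(* As usual in second order arithmetic, a set is finite when it is bounded. *)
Definition finite (D : nat) : form := ExN (AllN (#0 ∈ D ⇒ #0 ≺ #1)).

Definition le (R : nat) (x y : term) : form := pair x y ∈ R.
Definition lt (R : nat) (x y : term) : form := le R x y ∧ Not (x ≐ y).

Definition partial_order (L R : nat) : form :=
  AllN (AllN (le R #1 #0 ⇒ #1 ∈ L ∧ #0 ∈ L))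
  ∧ allIn L (le R #0 #0)
  ∧ allIn L (allIn L (le R #1 #0 ∧ le R #0 #1 ⇒ #1 ≐ #0))
  ∧ allIn L (allIn L (allIn L (le R #2 #1 ∧ le R #1 #0 ⇒ le R #2 #0))).

Definition is_join (L R : nat) (x y z : term) : form :=
  z ∈ L ∧ le R x z ∧ le R y z
  ∧ allIn L (le R ↑x #0 ∧ le R ↑y #0 ⇒ le R ↑z #0).

Definition is_meet (L R : nat) (x y z : term) : form :=
  z ∈ L ∧ le R z x ∧ le R z y
  ∧ allIn L (le R #0 ↑x ∧ le R #0 ↑y ⇒ le R #0 ↑z).

Definition lattice (L R : nat) : form :=
  partial_order L R
  ∧ allIn L (allIn L (ExN (is_join L R #2 #1 #0)))
  ∧ allIn L (allIn L (ExN (is_meet L R #2 #1 #0))).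

(* For x, y, z = #6, #5, #4:  x /\ (y \/ z) = (x /\ y) \/ (x /\ z), where
   #3 = y \/ z,  #2 = x /\ (y \/ z),  #1 = x /\ y,  #0 = x /\ z. *)
Definition distributive (L R : nat) : form :=
  allIn L (allIn L (allIn L (AllN (AllN (AllN (AllN
    (is_join L R #5 #4 #3 ∧ is_meet L R #6 #3 #2
     ∧ is_meet L R #6 #5 #1 ∧ is_meet L R #6 #4 #0
     ⇒ is_join L R #1 #0 #2))))))).

Definition is_sup (L R D : nat) (s : term) : form :=
  s ∈ L ∧ allIn D (le R #0 ↑s)
  ∧ allIn L (allIn D (le R #0 #1) ⇒ le R ↑s #0).

Definition is_inf (L R D : nat) (s : term) : form :=
  s ∈ L ∧ allIn D (le R ↑s #0)
  ∧ allIn L (allIn D (le R #1 #0) ⇒ le R #0 ↑s).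

Definition complete (L R : nat) : form :=
  AllS (subset 0 (S L) ⇒
    ExN (is_sup (S L) (S R) 0 #0) ∧ ExN (is_inf (S L) (S R) 0 #0)).

Definition le_sup (L R D : nat) (a : term) : form :=
  ExN (is_sup L R D #0 ∧ le R ↑a #0).

Definition compact (L R : nat) (a : term) : form :=
  AllS (subset 0 (S L) ⇒ le_sup (S L) (S R) 0 a ⇒
    ExS (subset 0 1 ∧ finite 0 ∧ le_sup (S (S L)) (S (S R)) 0 a)).

Definition compactly_generated (L R : nat) : form :=
  allIn L (ExS
    (subset 0 (S L) ∧ allIn 0 (compact (S L) (S R) #0)
     ∧ is_sup (S L) (S R) 0 #0)).

Definition algebraic (L R : nat) : form :=
  complete L R ∧ compactly_generated L R.

(* b ⊏ a *)
Definition coatom_below (L R : nat) (b a : term) : form :=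
  lt R b a ∧ Not (exIn L (lt R ↑b #0 ∧ lt R #0 ↑a)).

(* (∀x<a)(∃b)(x ≤ b ⊏ a); the caller supplies a ∈ L *)
Definition coatomic_below (L R : nat) (a : term) : form :=
  allIn L (lt R #0 ↑a ⇒ exIn L (le R #1 #0 ∧ coatom_below L R #0 ↑↑a)).

(* Main.v *)
From Stdlib Require Import Classical ClassicalEpsilon FunctionalExtensionality
  PropExtensionality Lia List Cantor Ring.
Import ListNotations.
Require Import Defs.
Local Open Scope soa_scope.

(** The calculus is complete: a formula that holds in all countable Tarski
    structures for $ACA_0$ is provable ([completeness]).  This is Henkin's
    argument.  It turns both claims into statements about one structure, whose
    numbers may be nonstandard, where induction and comprehension are available
    exactly for the arithmetically definable classes; [defP] singles these out
    and the tactic [definable] recognizes them.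

    Let $a$ be compact and $x < a$.  A coatom above $x$ is a maximal element of
    the interval $[x,a)$.  Building one greedily along the numbers would be a
    recursion; instead, the greedy element is approximated by those $y$ in the
    interval whose traces $\{m \mid m \le y\}$ are lexicographically maximal
    up to $n$.  For each $n$ there is one by induction, any two of them agree
    below $n$, so their traces converge to an arithmetical set $X$.  A finite
    part of $X$ is bounded by some such $y < a$, so compactness gives
    $\sup X < a$, and $\sup X$ is maximal because a larger element would have a
    lexicographically larger trace ([coatom_above]).

    Conversely, let every $x < a$ be below a coatom of $a$ and let $a = \sup K$
    with $K$ a set of compact elements.  If the part of $K$ below some number has
    supremum $a$, then $a$ is a finite join of compact elements, hence compact
    ([compact_of_part]).  Otherwise each such part is bounded by a coatom, and
    since no coatom bounds $K$, dependent choice gives coatoms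
    $b_0, b_1, \dots$ such that some part $K_i$ of $K$ is not bounded by $b_i$
    but bounded by all later ones.  For a set $X$ of these coatoms, $b_i$ is
    above $\inf X$ only if $b_i \in X$: an element of $K_i$ that is not below
    $b_i$ is a lower bound of the later members of $X$, and coatoms are prime in
    a distributive lattice, so that meeting it with the finitely many earlier
    members does not bring it below $b_i$.  Hence $X$ can be recovered from
    $\inf X$, which is impossible in a lattice of numbers: take
    $X = \{b_i \mid i \not\le b_i\}$ and $i = \inf X$
    ([separated_coatoms_absurd]).

    Dependent choice is the only place that needs arithmetic beyond the order of
    the numbers: the finite initial segments of the sequence are coded by
    Goedel's beta function ([coding]). *)

(** * Substitution *)

Definition upN (f : nat -> term) : nat -> term :=
  scons (Var 0) (fun n => liftT (f n)).
Definition upS (g : nat -> nat) : nat -> nat := scons 0 (fun X => S (g X)).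

Lemma substT_comp f f' t :
  substT f (substT f' t) = substT (fun n => substT f (f' n)) t.
Proof. induction t; simpl; congruence. Qed.

Lemma substT_Var t : substT Var t = t.
Proof. induction t; simpl; congruence. Qed.

Lemma upN_comp f f' :
  (fun n => substT (upN f) (upN f' n)) = upN (fun n => substT f (f' n)).
Proof.
  apply functional_extensionality; intros [|n]; simpl; [reflexivity|].
  unfold liftT; now rewrite !substT_comp.
Qed.

Lemma upS_comp g g' : (fun X => upS g (upS g' X)) = upS (fun X => g (g' X)).
Proof. apply functional_extensionality; now intros [|X]. Qed.

Lemma subst_comp A : forall f f' g g',
  subst f g (subst f' g' A)
  = subst (fun n => substT f (f' n)) (fun X => g (g' X)) A.
Proof.
  induction A; intros; simpl; rewrite ?substT_comp; try congruence.
  - now rewrite IHA1, IHA2.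
  - f_equal. fold (upN f) (upN f'). rewrite IHA, upN_comp. reflexivity.
  - f_equal. fold (upS g) (upS g'). rewrite IHA, upS_comp. reflexivity.
Qed.

Lemma upN_Var : upN Var = Var.
Proof. apply functional_extensionality; now intros [|n]. Qed.

Lemma upS_id : upS (fun X => X) = (fun X => X).
Proof. apply functional_extensionality; now intros [|n]. Qed.

Lemma subst_Var A : subst Var (fun X => X) A = A.
Proof.
  induction A; simpl; rewrite ?substT_Var; try congruence.
  - f_equal. fold (upN Var). now rewrite upN_Var.
  - f_equal. fold (upS (fun X => X)). now rewrite upS_id.
Qed.

Lemma instN_liftT s t : substT (scons s Var) (liftT t) = t.
Proof. unfold liftT; rewrite substT_comp; apply substT_Var. Qed.

Lemma subst_shiftN f g A : subst (upN f) g (shiftN A) = shiftN (subst f g A).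
Proof. unfold shiftN; now rewrite !subst_comp. Qed.

Lemma subst_shiftS f g A : subst f (upS g) (shiftS A) = shiftS (subst f g A).
Proof.
  unfold shiftS; rewrite !subst_comp. f_equal.
  apply functional_extensionality; intro n; simpl; now rewrite substT_Var.
Qed.

Lemma subst_instN f g t A :
  subst f g (instN t A) = instN (substT f t) (subst (upN f) g A).
Proof.
  unfold instN; rewrite !subst_comp. f_equal.
  apply functional_extensionality; intros [|n]; simpl; [reflexivity|].
  now rewrite instN_liftT.
Qed.

Lemma subst_instS f g X A :
  subst f g (instS X A) = instS (g X) (subst f (upS g) A).
Proof.
  unfold instS; rewrite !subst_comp. f_equal.
  - apply functional_extensionality; intro n; simpl; now rewrite substT_Var.
  - apply functional_extensionality; now intros [|Y].
Qed.

Lemma vars_belowT_mono t n n' : vars_belowT n t -> n <= n' -> vars_belowT n' t.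
Proof. induction t; simpl; intuition lia. Qed.

Lemma vars_below_mono A : forall n n' k k',
  vars_below n k A -> n <= n' -> k <= k' -> vars_below n' k' A.
Proof.
  induction A; simpl; intros m m' k k' H Hm Hk;
    intuition eauto using vars_belowT_mono with arith.
Qed.

Lemma vars_belowT_ex t : exists n, vars_belowT n t.
Proof.
  induction t as [n| | |s [n Hn] t [m Hm]|s [n Hn] t [m Hm]]; simpl;
    try (exists 0; exact I).
  - exists (S n); lia.
  - exists (n + m); split; eapply vars_belowT_mono; eauto; lia.
  - exists (n + m); split; eapply vars_belowT_mono; eauto; lia.
Qed.

Lemma vars_below_ex A : exists n, vars_below n n A.
Proof.
  induction A as [s t|s t|t X| |A [n Hn] B [m Hm]|A [n Hn]|A [n Hn]]; simpl.
  1,2: destruct (vars_belowT_ex s) as [n Hn], (vars_belowT_ex t) as [m Hm];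
    exists (n + m); split; eapply vars_belowT_mono; eauto; lia.
  - destruct (vars_belowT_ex t) as [n Hn]. exists (n + S X); split; [|lia].
    eapply vars_belowT_mono; eauto; lia.
  - now exists 0.
  - exists (n + m); split; eapply vars_below_mono; eauto; lia.
  - exists n; eapply vars_below_mono; eauto; lia.
  - exists n; eapply vars_below_mono; eauto; lia.
Qed.

Lemma vars_below_list (G : list form) :
  exists n, forall A, List.In A G -> vars_below n n A.
Proof.
  induction G as [|A G [n Hn]]; [exists 0; intros ? []|].
  destruct (vars_below_ex A) as [m Hm]. exists (n + m).
  intros B [<-|HB]; eapply vars_below_mono; eauto; lia.
Qed.

Lemma substT_agree t n f f' :
  vars_belowT n t -> (forall i, i < n -> f i = f' i) -> substT f t = substT f' t.
Proof.
  induction t; simpl; intros H E; try reflexivity; auto; f_equal; intuition.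
Qed.

Lemma subst_agree A : forall n k f f' g g',
  vars_below n k A -> (forall i, i < n -> f i = f' i) ->
  (forall X, X < k -> g X = g' X) -> subst f g A = subst f' g' A.
Proof.
  induction A; simpl; intros m k f f' g g' H Ef Eg; auto.
  - f_equal; eapply substT_agree; intuition eauto.
  - f_equal; eapply substT_agree; intuition eauto.
  - f_equal; [eapply substT_agree|]; intuition eauto.
  - f_equal; [eapply IHA1|eapply IHA2]; intuition eauto.
  - f_equal. eapply IHA; eauto. intros [|i] Hi; simpl; [reflexivity|].
    rewrite Ef by lia. reflexivity.
  - f_equal. eapply IHA; eauto. intros [|X] HX; simpl; [reflexivity|].
    rewrite Eg by lia. reflexivity.
Qed.

(** * Derivations *)

(** A member of [T] stands for its universal closure.  For theories that contain
    the substitution instances of their members, derivability itself is stable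
    under substitution, without a detour through the closures. *)
Definition subst_closed (T : form -> Prop) : Prop :=
  forall f g A, T A -> T (subst f g A).

Section Derivations.
Context {T : form -> Prop}.

Lemma prv_weaken G A : prv T G A -> forall G', incl G G' -> prv T G' A.
Proof.
  intro H; induction H; intros G' Hi.
  - now apply prv_ax.
  - apply prv_hyp; auto.
  - apply prv_impI. apply IHprv. intros C [<-|HC]; simpl; auto.
  - eapply prv_impE; eauto.
  - apply prv_raa. apply IHprv. intros C [<-|HC]; simpl; auto.
  - apply prv_allNI. apply IHprv. now apply incl_map.
  - apply prv_allNE; auto.
  - apply prv_allSI. apply IHprv. now apply incl_map.
  - apply prv_allSE; auto.
  - apply prv_refl.
  - eapply prv_leibniz; eauto.
Qed.

Lemma prv_exfalso G A : prv T G Bot -> prv T G A.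
Proof.
  intro H; apply prv_raa; eapply prv_weaken; eauto; now apply incl_tl, incl_refl.
Qed.

Lemma prv_subst (HT : subst_closed T) G A : prv T G A ->
  forall f g, prv T (map (subst f g) G) (subst f g A).
Proof.
  intro H; induction H; intros f g.
  - apply prv_ax; auto.
  - apply prv_hyp; now apply in_map.
  - apply prv_impI, IHprv.
  - eapply prv_impE; [apply IHprv1|apply IHprv2].
  - apply prv_raa, IHprv.
  - apply prv_allNI; fold (upN f). specialize (IHprv (upN f) g).
    rewrite map_map in *. erewrite map_ext; [exact IHprv|].
    intro; symmetry; apply subst_shiftN.
  - rewrite subst_instN. apply prv_allNE, IHprv.
  - apply prv_allSI; fold (upS g). specialize (IHprv f (upS g)).
    rewrite map_map in *. erewrite map_ext; [exact IHprv|].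
    intro; symmetry; apply subst_shiftS.
  - rewrite subst_instS. apply prv_allSE, IHprv.
  - apply prv_refl.
  - rewrite subst_instN. eapply prv_leibniz; [apply IHprv1|].
    rewrite <- subst_instN; apply IHprv2.
Qed.

(** Renaming the fresh variable [n] to [0] and shifting the others turns the
    premise into the premise of the introduction rule. *)
Lemma allN_fresh (HT : subst_closed T) G A n :
  (forall B, List.In B G -> vars_below n n B) -> vars_below n n (AllN A) ->
  prv T G (instN (Var n) A) -> prv T G (AllN A).
Proof.
  intros HG HA H.
  set (f := fun i => if PeanoNat.Nat.eqb i n then Var 0 else Var (S i)).
  assert (Hf : forall i, i < n -> f i = Var (S i)).
  { intros i Hi; unfold f. destruct (PeanoNat.Nat.eqb_spec i n); [lia|auto]. }
  apply prv_allNI. apply (prv_subst HT) with (f := f) (g := fun X => X) in H.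
  replace (subst f (fun X => X) (instN (Var n) A)) with A in H.
  - erewrite map_ext_in; [exact H|]. intros B HB; symmetry.
    eapply subst_agree; [apply HG, HB|auto|auto].
  - unfold instN; rewrite subst_comp. rewrite <- (subst_Var A) at 1.
    eapply subst_agree; [exact HA| |auto]. intros [|i] Hi; simpl.
    + unfold f; now rewrite PeanoNat.Nat.eqb_refl.
    + rewrite Hf by lia. reflexivity.
Qed.

Lemma allS_fresh (HT : subst_closed T) G A n :
  (forall B, List.In B G -> vars_below n n B) -> vars_below n n (AllS A) ->
  prv T G (instS n A) -> prv T G (AllS A).
Proof.
  intros HG HA H.
  set (g := fun i => if PeanoNat.Nat.eqb i n then 0 else S i).
  assert (Hg : forall i, i < n -> g i = S i).
  { intros i Hi; unfold g. destruct (PeanoNat.Nat.eqb_spec i n); [lia|auto]. }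
  apply prv_allSI. apply (prv_subst HT) with (f := Var) (g := g) in H.
  replace (subst Var g (instS n A)) with A in H.
  - erewrite map_ext_in; [exact H|]. intros B HB; symmetry.
    eapply subst_agree; [apply HG, HB|auto|auto].
  - unfold instS; rewrite subst_comp. rewrite <- (subst_Var A) at 1.
    eapply subst_agree; [exact HA|auto|]. intros [|i] Hi; simpl.
    + unfold g; now rewrite PeanoNat.Nat.eqb_refl.
    + rewrite Hg by lia. reflexivity.
Qed.

End Derivations.

(** * Enumeration of the language *)

Fixpoint codeT (t : term) : nat :=
  match t with
  | Var n => to_nat (0, n)
  | Zero => to_nat (1, 0)
  | One => to_nat (2, 0)
  | Add s t => to_nat (3, to_nat (codeT s, codeT t))
  | Mul s t => to_nat (4, to_nat (codeT s, codeT t))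
  end.

Fixpoint code (A : form) : nat :=
  match A with
  | Eq s t => to_nat (0, to_nat (codeT s, codeT t))
  | Lt s t => to_nat (1, to_nat (codeT s, codeT t))
  | In t X => to_nat (2, to_nat (codeT t, X))
  | Bot => to_nat (3, 0)
  | Imp A B => to_nat (4, to_nat (code A, code B))
  | AllN A => to_nat (5, code A)
  | AllS A => to_nat (6, code A)
  end.

Opaque to_nat.

Lemma to_nat_pair_inj x y x' y' :
  to_nat (x, y) = to_nat (x', y') -> x = x' /\ y = y'.
Proof.
  intro H. apply (f_equal of_nat) in H. rewrite !cancel_of_to in H.
  now injection H.
Qed.

Ltac code_inj :=
  repeat match goal with
  | H : to_nat _ = to_nat _ |- _ =>
      apply to_nat_pair_inj in H; destruct H
  end.

Lemma codeT_inj s : forall t, codeT s = codeT t -> s = t.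
Proof.
  induction s; intros [] E; cbn in E; code_inj; try discriminate;
    f_equal; auto.
Qed.

Lemma code_inj A : forall B, code A = code B -> A = B.
Proof.
  induction A; intros [] E; cbn in E; code_inj; try discriminate;
    f_equal; auto using codeT_inj.
Qed.

Definition countable (X : Type) : Prop :=
  exists e : nat -> X, forall x, exists n, e n = x.

Lemma countable_inj (X : Type) (x0 : X) (c : X -> nat) :
  (forall x y, c x = c y -> x = y) -> countable X.
Proof.
  intro Hc. exists (fun n => epsilon (inhabits x0) (fun x => c x = n)).
  intro x; exists (c x). apply Hc.
  apply (epsilon_spec (inhabits x0) (fun y => c y = c x)); eauto.
Qed.

(** * Completeness for countable Tarski structures *)

Record structure : Type := {
  num : Type;
  sets : Type;
  zero : num;
  one : num;
  add : num -> num -> num;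
  mul : num -> num -> num;
  ltN : num -> num -> Prop;
  mem : num -> sets -> Prop
}.

Fixpoint eval (M : structure) (rho : nat -> num M) (t : term) : num M :=
  match t with
  | Var n => rho n
  | Zero => zero M
  | One => one M
  | Add s t => add M (eval M rho s) (eval M rho t)
  | Mul s t => mul M (eval M rho s) (eval M rho t)
  end.

Fixpoint sat (M : structure) (rho : nat -> num M) (sigma : nat -> sets M)
    (A : form) : Prop :=
  match A with
  | Eq s t => eval M rho s = eval M rho t
  | Lt s t => ltN M (eval M rho s) (eval M rho t)
  | In t X => mem M (eval M rho t) (sigma X)
  | Bot => False
  | Imp A B => sat M rho sigma A -> sat M rho sigma B
  | AllN A => forall x, sat M (scons x rho) sigma A
  | AllS A => forall X, sat M rho (scons X sigma) A
  end.

Definition models (M : structure) (T : form -> Prop) : Prop :=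
  forall A, T A -> forall rho sigma, sat M rho sigma A.

Section Henkin.
Context (T : form -> Prop) (HT : subst_closed T).

Definition consistent (G : list form) : Prop := ~ prv T G Bot.

(** Decided formulas are settled together with a witness, as the truth lemma
    requires of a refuted universal formula. *)
Definition decides (G : list form) (A : form) : Prop :=
  List.In A G \/
  List.In (Not A) G
  /\ (forall B, A = AllN B -> exists t, List.In (Not (instN t B)) G)
  /\ (forall B, A = AllS B -> exists X, List.In (Not (instS X B)) G).

(** A counterexample to a refuted universal formula can be named by a variable
    that is fresh for the finite context. *)
Lemma decide_step G A : consistent G ->
  exists G', consistent G' /\ incl G G' /\ decides G' A.
Proof.
  intro HG. destruct (classic (prv T (A :: G) Bot)) as [HA|HA].
  2: { exists (A :: G); repeat split; auto using incl_tl, incl_refl.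
       left; now left. }
  assert (HnA : consistent (Not A :: G)).
  { intro H. apply HG. apply prv_impE with A.
    - now apply prv_impI.
    - now apply prv_raa. }
  assert (Hraa : forall C, prv T (Not C :: Not A :: G) Bot ->
    (prv T (Not A :: G) C -> prv T (Not A :: G) A) -> False).
  { intros C H1 H2. apply HnA. apply prv_impE with A.
    - apply prv_hyp; now left.
    - now apply H2, prv_raa. }
  assert (Hi : forall C, incl G (C :: Not A :: G))
    by (intro C; apply incl_tl, incl_tl, incl_refl).
  destruct (vars_below_list (Not A :: G)) as [n Hn].
  assert (Hn' : vars_below n n A) by (apply (Hn (Not A)); now left).
  destruct A as [| | | | |B|B].
  1-5: eexists (Not _ :: G); split; [exact HnA|];
    split; [apply incl_tl, incl_refl|right;
      split; [now left|split; intros ? E; discriminate E]].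
  - exists (Not (instN (Var n) B) :: Not (AllN B) :: G). split; [|split].
    + intro H. apply (Hraa _ H). now apply allN_fresh.
    + apply Hi.
    + right; split; [right; now left|split; intros C E; [|discriminate E]].
      injection E as <-. exists (Var n); now left.
  - exists (Not (instS n B) :: Not (AllS B) :: G). split; [|split].
    + intro H. apply (Hraa _ H). now apply allS_fresh.
    + apply Hi.
    + right; split; [right; now left|split; intros C E; [discriminate E|]].
      injection E as <-. exists n; now left.
Qed.

Section Chain.
Context (G0 : list form) (HG0 : consistent G0).
Context (enum : nat -> form) (Henum : forall A, exists n, enum n = A).

Fixpoint chain (n : nat) : list form :=
  match n with
  | 0 => G0
  | S n => epsilon (inhabits [])
      (fun G' => consistent G' /\ incl (chain n) G' /\ decides G' (enum n))
  end.

Lemma chain_spec n : consistent (chain n) /\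
  incl (chain n) (chain (S n)) /\ decides (chain (S n)) (enum n).
Proof.
  assert (step : forall n, consistent (chain n) ->
    consistent (chain (S n)) /\ incl (chain n) (chain (S n))
    /\ decides (chain (S n)) (enum n)).
  { intros m Hm. exact (epsilon_spec _ _ (decide_step _ (enum m) Hm)). }
  assert (H : consistent (chain n)).
  { induction n as [|n IH]; [exact HG0|apply (step n IH)]. }
  destruct (step n H); auto.
Qed.

Lemma chain_mono n m : n <= m -> incl (chain n) (chain m).
Proof.
  induction 1; [apply incl_refl|].
  eapply incl_tran; [eassumption|apply chain_spec].
Qed.

(** Derivability from some stage rather than membership in it, so that closure
    under the rules holds by weakening. *)
Definition Omega (A : form) : Prop := exists n, prv T (chain n) A.

Lemma Omega_prv1 A B :
  (forall G, prv T G A -> prv T G B) -> Omega A -> Omega B.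
Proof. intros H [n Hn]; exists n; auto. Qed.

Lemma Omega_prv2 A B C :
  (forall G, prv T G A -> prv T G B -> prv T G C) -> Omega A -> Omega B -> Omega C.
Proof.
  intros H [n Hn] [m Hm]; exists (n + m); apply H; eapply prv_weaken; eauto;
    apply chain_mono; lia.
Qed.

Lemma Omega_prv A : (forall G, prv T G A) -> Omega A.
Proof. intros H; exists 0; apply H. Qed.

Lemma Omega_Bot : ~ Omega Bot.
Proof. intros [n Hn]. now apply (proj1 (chain_spec n)). Qed.

Lemma Omega_decides A : Omega A \/
  Omega (Not A)
  /\ (forall B, A = AllN B -> exists t, Omega (Not (instN t B)))
  /\ (forall B, A = AllS B -> exists X, Omega (Not (instS X B))).
Proof.
  destruct (Henum A) as [n <-].
  destruct (chain_spec n) as (_ & _ & [H|(H & HN & HS)]); [left|right];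
    [|split; [|split]].
  - exists (S n); now apply prv_hyp.
  - exists (S n); now apply prv_hyp.
  - intros B E. destruct (HN B E) as [t Ht].
    exists t, (S n); now apply prv_hyp.
  - intros B E. destruct (HS B E) as [X HX].
    exists X, (S n); now apply prv_hyp.
Qed.

Lemma Omega_Not A : Omega (Not A) -> ~ Omega A.
Proof.
  intros H1 H2. apply Omega_Bot. revert H1 H2. apply Omega_prv2.
  intros G; apply prv_impE.
Qed.

Lemma Omega_Imp A B : Omega (A ⇒ B) <-> (Omega A -> Omega B).
Proof.
  split.
  - apply Omega_prv2. intros G; apply prv_impE.
  - intro H. destruct (Omega_decides A) as [HA|[HA _]].
    + generalize (H HA). apply Omega_prv1. intros G HB. apply prv_impI.
      eapply prv_weaken; [exact HB|apply incl_tl, incl_refl].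
    + revert HA. apply Omega_prv1. intros G HA. apply prv_impI, prv_exfalso.
      apply prv_impE with A; [|apply prv_hyp; now left].
      eapply prv_weaken; [exact HA|apply incl_tl, incl_refl].
Qed.

Lemma Omega_AllN A : Omega (AllN A) <-> forall t, Omega (instN t A).
Proof.
  split.
  - intros H t; revert H. apply Omega_prv1. intros G H; now apply prv_allNE.
  - intro H. destruct (Omega_decides (AllN A)) as [HA|[_ [HA _]]]; [exact HA|].
    destruct (HA A eq_refl) as [t Ht]. destruct (Omega_Not _ Ht (H t)).
Qed.

Lemma Omega_AllS A : Omega (AllS A) <-> forall X, Omega (instS X A).
Proof.
  split.
  - intros H X; revert H. apply Omega_prv1. intros G H; now apply prv_allSE.
  - intro H. destruct (Omega_decides (AllS A)) as [HA|[_ [_ HA]]]; [exact HA|].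
    destruct (HA A eq_refl) as [X HX]. destruct (Omega_Not _ HX (H X)).
Qed.

Lemma Omega_leibniz A s t :
  Omega (s ≐ t) -> Omega (instN s A) -> Omega (instN t A).
Proof. apply Omega_prv2. intro G; apply prv_leibniz. Qed.

Lemma Omega_refl t : Omega (t ≐ t).
Proof. apply Omega_prv; intro; apply prv_refl. Qed.

Lemma Omega_sym s t : Omega (s ≐ t) -> Omega (t ≐ s).
Proof.
  intro H. pose proof (Omega_leibniz (#0 ≐ ↑s) s t H) as L.
  cbn in L; rewrite !instN_liftT in L. apply L, Omega_refl.
Qed.

Lemma Omega_trans s t u : Omega (s ≐ t) -> Omega (t ≐ u) -> Omega (s ≐ u).
Proof.
  intros H H'. pose proof (Omega_leibniz (↑s ≐ #0) t u H') as L.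
  cbn in L; rewrite !instN_liftT in L. auto.
Qed.

Lemma Omega_cong (c : term -> term -> term) :
  (forall f s t, substT f (c s t) = c (substT f s) (substT f t)) ->
  forall s s' t t', Omega (s ≐ s') -> Omega (t ≐ t') ->
    Omega (c s t ≐ c s' t').
Proof.
  intros Hc s s' t t' Hs Ht.
  pose proof (Omega_leibniz (c ↑s ↑t ≐ c #0 ↑t) s s' Hs) as L1.
  pose proof (Omega_leibniz (c ↑s ↑t ≐ c ↑s' #0) t t' Ht) as L2.
  cbn in L1, L2; rewrite !Hc in L1, L2; cbn in L1, L2.
  rewrite !instN_liftT in L1; rewrite !instN_liftT in L2.
  apply L2, L1, Omega_refl.
Qed.

Lemma Omega_Lt_cong s s' t t' : Omega (s ≐ s') -> Omega (t ≐ t') ->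
  Omega (s ≺ t) -> Omega (s' ≺ t').
Proof.
  intros Hs Ht H.
  pose proof (Omega_leibniz (#0 ≺ ↑t) s s' Hs) as L1.
  pose proof (Omega_leibniz (↑s' ≺ #0) t t' Ht) as L2.
  cbn in L1, L2.
  rewrite !instN_liftT in L1; rewrite !instN_liftT in L2. auto.
Qed.

(** Each term is replaced by a representative of its class modulo provable
    equality, so that equality in the structure is Leibniz equality. *)
Definition rep (t : term) : term :=
  epsilon (inhabits Zero) (fun s => Omega (t ≐ s)).

Lemma rep_eq t : Omega (t ≐ rep t).
Proof.
  apply (epsilon_spec (inhabits Zero) (fun s => Omega (t ≐ s))).
  exists t; apply Omega_refl.
Qed.

Lemma rep_iff s t : rep s = rep t <-> Omega (s ≐ t).
Proof.
  split.
  - intro E. apply Omega_trans with (rep s); [apply rep_eq|].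
    rewrite E. apply Omega_sym, rep_eq.
  - intro H. unfold rep. f_equal. apply functional_extensionality; intro u.
    apply propositional_extensionality; split; intro K;
      eauto using Omega_trans, Omega_sym.
Qed.

Lemma rep_idem t : rep (rep t) = rep t.
Proof. apply rep_iff, Omega_sym, rep_eq. Qed.

Definition reps : Type := { t : term | rep t = t }.
Definition cls (t : term) : reps := exist _ (rep t) (rep_idem t).

Lemma reps_eq (x y : reps) : proj1_sig x = proj1_sig y -> x = y.
Proof. apply eq_sig_hprop; intros; apply proof_irrelevance. Qed.

Lemma cls_iff s t : cls s = cls t <-> Omega (s ≐ t).
Proof.
  rewrite <- rep_iff. split; [now injection 1|]. now intro; apply reps_eq.
Qed.

Lemma cls_val (x : reps) : cls (proj1_sig x) = x.
Proof. apply reps_eq. exact (proj2_sig x). Qed.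

Definition term_structure : structure := {|
  num := reps;
  sets := nat;
  zero := cls Zero;
  one := cls One;
  add x y := cls (Add (proj1_sig x) (proj1_sig y));
  mul x y := cls (Mul (proj1_sig x) (proj1_sig y));
  ltN x y := Omega (proj1_sig x ≺ proj1_sig y);
  mem x X := Omega (proj1_sig x ∈ X)
|}.

Lemma eval_term t f :
  eval term_structure (fun n => cls (f n)) t = cls (substT f t).
Proof.
  induction t; cbn; try reflexivity;
    rewrite IHt1, IHt2; apply cls_iff; cbn;
    apply Omega_sym, Omega_cong; auto using rep_eq.
Qed.

Lemma cls_scons t f :
  scons (cls t) (fun n => cls (f n)) = (fun n => cls (scons t f n)).
Proof. apply functional_extensionality; now intros [|n]. Qed.

(** Truth is tested at all substitutions at once: an instance of a quantified
    formula is then again a substitution instance of its body, and the induction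
    is structural. *)
Lemma truth A : forall f g,
  sat term_structure (fun n => cls (f n)) g A <-> Omega (subst f g A).
Proof.
  induction A; intros f g; cbn [sat subst]; rewrite ?eval_term.
  - apply cls_iff.
  - split; apply Omega_Lt_cong; auto using rep_eq, Omega_sym.
  - cbn. split.
    + intro H. pose proof (Omega_leibniz (#0 ∈ g X) _ _
        (Omega_sym _ _ (rep_eq (substT f t)))) as L. auto.
    + intro H. pose proof (Omega_leibniz (#0 ∈ g X) _ _
        (rep_eq (substT f t))) as L. auto.
  - split; [intros []|apply Omega_Bot].
  - rewrite IHA1, IHA2. symmetry; apply Omega_Imp.
  - fold (upN f). rewrite Omega_AllN.
    assert (E : forall t, instN t (subst (upN f) g A) = subst (scons t f) g A).
    { intro t. unfold instN; rewrite subst_comp. f_equal.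
      apply functional_extensionality; intros [|n]; cbn; [reflexivity|].
      apply instN_liftT. }
    split.
    + intros H t. rewrite E. apply IHA. rewrite <- cls_scons. apply H.
    + intros H x. rewrite <- (cls_val x), cls_scons. apply IHA.
      rewrite <- E. apply H.
  - fold (upS g). rewrite Omega_AllS.
    assert (E : forall X, instS X (subst f (upS g) A) = subst f (scons X g) A).
    { intro X. unfold instS; rewrite subst_comp. f_equal.
      - apply functional_extensionality; intros n; apply substT_Var.
      - apply functional_extensionality; now intros [|Y]. }
    split; intros H X; [rewrite E; apply IHA, H|apply IHA; rewrite <- E; apply H].
Qed.

End Chain.

(** Countability costs nothing here, the structure being made of terms and set
    variables, and it lets elements of a structure be named by variables. *)
Theorem completeness A :
  (forall M, countable (num M) -> countable (sets M) -> models M T ->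
     forall rho sigma, sat M rho sigma A) ->
  provable T A.
Proof.
  intro H. apply NNPP; intro HA.
  assert (HG : consistent [Not A]) by (intro K; now apply HA, prv_raa).
  destruct (countable_inj form Bot code code_inj) as [enum Henum].
  set (M := term_structure [Not A] HG enum).
  assert (Hcls : forall rho : nat -> num M,
    rho = fun n => cls [Not A] HG enum (proj1_sig (rho n))).
  { intro rho; apply functional_extensionality; intro n.
    symmetry; apply cls_val; auto. }
  apply (Omega_Not [Not A] HG enum A).
  - exists 0. apply prv_hyp; now left.
  - pose proof (proj1 (truth [Not A] HG enum Henum A Var (fun X => X))) as Tr.
    rewrite subst_Var in Tr. apply Tr.
    apply (H M).
    + destruct (countable_inj term Zero codeT codeT_inj) as [e He].
      exists (fun n => cls [Not A] HG enum (e n)). intro x.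
      destruct (He (proj1_sig x)) as [n Hn]. exists n.
      rewrite Hn; apply cls_val; auto.
    + exists (fun X => X); eauto.
    + intros B HB rho sigma. rewrite (Hcls rho). apply (truth [Not A] HG enum Henum).
      exists 0. now apply prv_ax, HT.
Qed.

End Henkin.

(** * Truth of derived connectives and substituted formulas *)

Section Truth.
Context (M : structure).
Implicit Types (rho : nat -> num M) (sigma : nat -> sets M).

Lemma sat_And rho sigma A B :
  sat M rho sigma (A ∧ B) <-> sat M rho sigma A /\ sat M rho sigma B.
Proof. cbn; tauto. Qed.

Lemma sat_Or rho sigma A B :
  sat M rho sigma (A ∨ B) <-> sat M rho sigma A \/ sat M rho sigma B.
Proof. cbn; tauto. Qed.

Lemma sat_Iff rho sigma A B :
  sat M rho sigma (A ⇔ B) <-> (sat M rho sigma A <-> sat M rho sigma B).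
Proof. cbn; tauto. Qed.

Lemma sat_ExN rho sigma A :
  sat M rho sigma (ExN A) <-> exists x, sat M (scons x rho) sigma A.
Proof.
  cbn; split; [|firstorder].
  intro H; apply NNPP; intro K; apply H; intros x Hx; eauto.
Qed.

Lemma sat_ExS rho sigma A :
  sat M rho sigma (ExS A) <-> exists X, sat M rho (scons X sigma) A.
Proof.
  cbn; split; [|firstorder].
  intro H; apply NNPP; intro K; apply H; intros X HX; eauto.
Qed.

Lemma eval_substT rho f t :
  eval M rho (substT f t) = eval M (fun n => eval M rho (f n)) t.
Proof. induction t; cbn; congruence. Qed.

Lemma eval_liftT rho x t : eval M (scons x rho) (liftT t) = eval M rho t.
Proof. unfold liftT; now rewrite eval_substT. Qed.

Lemma sat_subst A : forall rho sigma f g,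
  sat M rho sigma (subst f g A)
  <-> sat M (fun n => eval M rho (f n)) (fun X => sigma (g X)) A.
Proof.
  induction A; intros rho sigma f g; cbn [sat subst]; rewrite ?eval_substT;
    try reflexivity.
  - now rewrite IHA1, IHA2.
  - fold (upN f).
    assert (E : forall x, scons x (fun n => eval M rho (f n))
      = (fun n => eval M (scons x rho) (upN f n))).
    { intro x; apply functional_extensionality; intros [|n]; cbn;
        [reflexivity|now rewrite eval_liftT]. }
    split; intros H x; specialize (H x).
    + apply IHA in H. now rewrite E.
    + apply IHA. now rewrite <- E.
  - fold (upS g).
    assert (E : forall X, scons X (fun Y => sigma (g Y))
      = (fun Y => scons X sigma (upS g Y))).
    { intro X; apply functional_extensionality; now intros [|Y]. }
    split; intros H X; specialize (H X).
    + apply IHA in H. now rewrite E.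
    + apply IHA. now rewrite <- E.
Qed.

Lemma sat_shiftS rho sigma X A :
  sat M rho (scons X sigma) (shiftS A) <-> sat M rho sigma A.
Proof. unfold shiftS; now rewrite sat_subst. Qed.

End Truth.

Lemma arithmetical_subst A : forall f g,
  arithmetical A -> arithmetical (subst f g A).
Proof. induction A; cbn; firstorder. Qed.

Lemma ACA0_subst_closed : subst_closed ACA0.
Proof.
  intros f g A HA; destruct HA;
    try (cbn; constructor; fail).
  change (ACA0 (ExS (AllN (#0 ∈ 0 ⇔ subst (upN f) (upS g) (shiftS A))))).
  rewrite subst_shiftS. apply aca_comprehension. now apply arithmetical_subst.
Qed.

(** * Countable models of arithmetical comprehension *)

Section Model.
Context (M : structure) (HM : models M ACA0).
Context (name : nat -> num M) (Hname : forall x, exists n, name n = x).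
Context (sname : nat -> sets M) (Hsname : forall X, exists n, sname n = X).

Notation N := (num M).
Notation "0" := (zero M).
Notation "1" := (one M).
Notation "x + y" := (add M x y).
Notation "x * y" := (mul M x y).
Notation "x < y" := (ltN M x y).
Notation "x ∈ X" := (mem M x X).

(** ** Arithmetical definability *)

(** The values of the [k] innermost variables; all outer variables are used as
    names of parameters. *)
Fixpoint env (k : nat) : Type :=
  match k with O => unit | S k => (N * env k)%type end.

Fixpoint assign {k : nat} : env k -> nat -> N :=
  match k with
  | O => fun _ => name
  | S k => fun e => scons (fst e) (assign (snd e))
  end.

(** As every number and every set of the structure has a name, arbitrary
    elements of the structure may occur as parameters. *)
Definition defT k (t : env k -> N) : Prop :=
  exists s, forall e, eval M (assign e) s = t e.
Definition defP k (P : env k -> Prop) : Prop :=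
  exists A, arithmetical A /\ forall e, sat M (assign e) sname A <-> P e.

Lemma assign_name k (e : env k) n : assign e (Nat.add k n) = name n.
Proof. induction k; cbn; auto. Qed.

Lemma defT_const k x : defT k (fun _ => x).
Proof.
  destruct (Hname x) as [n <-]. exists (Var (Nat.add k n)).
  intro e; apply assign_name.
Qed.

Lemma defT_fst k : defT (S k) (fun e => fst e).
Proof. now exists (Var O). Qed.

Lemma defT_snd k t : defT k t -> defT (S k) (fun e => t (snd e)).
Proof.
  intros [s Hs]. exists (liftT s). intro e.
  rewrite <- Hs; cbn. apply eval_liftT.
Qed.

Definition defT_snd1 k := defT_snd _ _ (defT_fst k).
Definition defT_snd2 k := defT_snd _ _ (defT_snd1 k).
Definition defT_snd3 k := defT_snd _ _ (defT_snd2 k).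
Definition defT_snd4 k := defT_snd _ _ (defT_snd3 k).
Definition defT_snd5 k := defT_snd _ _ (defT_snd4 k).
Definition defT_snd6 k := defT_snd _ _ (defT_snd5 k).

Lemma defT_add k t t' : defT k t -> defT k t' -> defT k (fun e => t e + t' e).
Proof.
  intros [s Hs] [s' Hs']. exists (Add s s'). intro e; cbn; congruence.
Qed.

Lemma defT_mul k t t' : defT k t -> defT k t' -> defT k (fun e => t e * t' e).
Proof.
  intros [s Hs] [s' Hs']. exists (Mul s s'). intro e; cbn; congruence.
Qed.

Lemma defP_eq k t t' : defT k t -> defT k t' -> defP k (fun e => t e = t' e).
Proof.
  intros [s Hs] [s' Hs']. exists (Eq s s').
  split; [exact I|]. intro e; cbn; now rewrite Hs, Hs'.
Qed.

Lemma defP_lt k t t' : defT k t -> defT k t' -> defP k (fun e => t e < t' e).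
Proof.
  intros [s Hs] [s' Hs']. exists (Lt s s').
  split; [exact I|]. intro e; cbn; now rewrite Hs, Hs'.
Qed.

Lemma defP_mem k t X : defT k t -> defP k (fun e => t e ∈ X).
Proof.
  intros [s Hs]. destruct (Hsname X) as [n <-]. exists (In s n).
  split; [exact I|]. intro e; cbn; now rewrite Hs.
Qed.

Lemma defP_const k (P : Prop) : defP k (fun _ => P).
Proof.
  destruct (classic P) as [H|H]; [exists (Not Bot)|exists Bot];
    cbn; tauto.
Qed.

Lemma defP_imp k P Q : defP k P -> defP k Q -> defP k (fun e => P e -> Q e).
Proof.
  intros (A & HA & HP) (B & HB & HQ). exists (Imp A B).
  split; [now split|]. intro e; cbn; now rewrite HP, HQ.
Qed.

Lemma defP_ext k P Q : (forall e, P e <-> Q e) -> defP k P -> defP k Q.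
Proof.
  intros E (A & HA & HP). exists A. split; [exact HA|].
  intro e; now rewrite HP, E.
Qed.

Lemma defP_not k P : defP k P -> defP k (fun e => ~ P e).
Proof. intro H; apply defP_imp; [exact H|apply defP_const]. Qed.

Lemma defP_and k P Q : defP k P -> defP k Q -> defP k (fun e => P e /\ Q e).
Proof.
  intros HP HQ. apply defP_ext with (P := fun e => ~ (P e -> ~ Q e)).
  - intro e; tauto.
  - now apply defP_not, defP_imp, defP_not.
Qed.

Lemma defP_or k P Q : defP k P -> defP k Q -> defP k (fun e => P e \/ Q e).
Proof.
  intros HP HQ. apply defP_ext with (P := fun e => ~ P e -> Q e).
  - intro e; tauto.
  - now apply defP_imp; [apply defP_not|].
Qed.

Lemma defP_iff k P Q : defP k P -> defP k Q -> defP k (fun e => P e <-> Q e).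
Proof. intros HP HQ; apply defP_and; now apply defP_imp. Qed.

Lemma defP_all k (P : env k -> N -> Prop) :
  defP (S k) (fun e => P (snd e) (fst e)) -> defP k (fun e => forall x, P e x).
Proof.
  intros (A & HA & HP). exists (AllN A). split; [exact HA|]. intro e; cbn.
  split; intros H x; specialize (H x).
  - now apply (HP (x, e)) in H.
  - now apply (HP (x, e)).
Qed.

Lemma defP_ex k (P : env k -> N -> Prop) :
  defP (S k) (fun e => P (snd e) (fst e)) -> defP k (fun e => exists x, P e x).
Proof.
  intro H. apply defP_ext with (P := fun e => ~ forall x, ~ P e x).
  - intro e; split; [|firstorder].
    intro K; apply NNPP; intro K'; apply K; intros x Hx; eauto.
  - apply defP_not, defP_all. now apply defP_not.
Qed.

(** Reads off a defining formula by recursion on the predicate. The constant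
    rules come first, so that subterms without variables become parameters;
    defined predicates are unfolded by unification. *)
Ltac definable := repeat first
  [ apply defP_const | apply defT_const | apply defT_fst
  | apply defP_and | apply defP_or | apply defP_iff | apply defP_not
  | apply defP_ex | apply defP_all | apply defP_imp
  | apply defP_eq | apply defP_lt | apply defP_mem
  | apply defT_add | apply defT_mul
  | apply defT_snd1 | apply defT_snd2 | apply defT_snd3
  | apply defT_snd4 | apply defT_snd5 | apply defT_snd6 ].

Lemma comprehension (P : N -> Prop) :
  defP 1%nat (fun e => P (fst e)) -> exists X, forall x, x ∈ X <-> P x.
Proof.
  intros (A & HA & HP).
  pose proof (HM _ (aca_comprehension A HA) name sname) as H.
  apply sat_ExS in H. destruct H as [X H]. exists X. intro x.
  specialize (H x). change (sat M (scons x name) (scons X sname)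
    (Iff (In (Var O) O) (shiftS A))) in H.
  rewrite sat_Iff, sat_shiftS in H. rewrite <- (HP (x, tt)). exact H.
Qed.

Lemma arith_ind (P : N -> Prop) : defP 1%nat (fun e => P (fst e)) ->
  P 0 -> (forall x, P x -> P (x + 1)) -> forall x, P x.
Proof.
  intros HP H0 HS. destruct (comprehension P HP) as [X HX].
  pose proof (HM _ aca_induction name sname X) as H. cbn in H.
  intro x. apply HX. apply H. intro K. apply K.
  - now apply HX.
  - intro y. rewrite !HX. apply HS.
Qed.

(** ** Arithmetic *)

Lemma succ_neq0 x : x + 1 <> 0.
Proof. exact (HM _ aca_succ_nonzero name sname x). Qed.

Lemma succ_inj x y : x + 1 = y + 1 -> x = y.
Proof. exact (HM _ aca_succ_inj name sname x y). Qed.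

Lemma add_0 x : x + 0 = x.
Proof. exact (HM _ aca_add_zero name sname x). Qed.

Lemma add_S x y : x + (y + 1) = (x + y) + 1.
Proof. exact (HM _ aca_add_succ name sname x y). Qed.

Lemma mul_0 x : x * 0 = 0.
Proof. exact (HM _ aca_mul_zero name sname x). Qed.

Lemma mul_S x y : x * (y + 1) = x * y + x.
Proof. exact (HM _ aca_mul_succ name sname x y). Qed.

Lemma lt_0 x : ~ x < 0.
Proof. exact (HM _ aca_lt_zero name sname x). Qed.

Lemma lt_S x y : x < y + 1 <-> x < y \/ x = y.
Proof.
  pose proof (HM _ aca_lt_succ name sname x y) as H.
  change (sat M (scons y (scons x name)) sname
    (Iff (Lt (Var 1) (Add (Var 0) One))
       (Or (Lt (Var 1) (Var 0)) (Eq (Var 1) (Var 0))))) in H.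
  now rewrite sat_Iff, sat_Or in H.
Qed.

Ltac induct x :=
  pattern x; apply arith_ind; [definable|clear x|clear x; intros x].

Lemma add_assoc x y z : x + (y + z) = (x + y) + z.
Proof.
  induct z; [now rewrite !add_0|]. intro IH. now rewrite !add_S, IH.
Qed.

Lemma add_0l x : 0 + x = x.
Proof. induct x; [apply add_0|]. intro IH. now rewrite add_S, IH. Qed.

Lemma add_Sl x y : (x + 1) + y = (x + y) + 1.
Proof.
  induct y; [now rewrite !add_0|]. intro IH. now rewrite !add_S, IH.
Qed.

Lemma add_comm x y : x + y = y + x.
Proof.
  induct y; [now rewrite add_0, add_0l|]. intro IH. now rewrite add_S, add_Sl, IH.
Qed.

Lemma mul_0l x : 0 * x = 0.
Proof. induct x; [apply mul_0|]. intro IH. now rewrite mul_S, IH, add_0. Qed.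

Lemma mul_1l x : 1 * x = x.
Proof. induct x; [apply mul_0|]. intro IH. now rewrite mul_S, IH. Qed.

Lemma mul_Sl x y : (x + 1) * y = x * y + y.
Proof.
  induct y; [now rewrite !mul_0, add_0|]. intro IH.
  rewrite !mul_S, IH, !add_S. f_equal.
  rewrite <- !add_assoc. f_equal. apply add_comm.
Qed.

Lemma mul_comm x y : x * y = y * x.
Proof.
  induct y; [now rewrite mul_0, mul_0l|]. intro IH. now rewrite mul_S, mul_Sl, IH.
Qed.

Lemma mul_addl x y z : (x + y) * z = x * z + y * z.
Proof.
  induct z; [now rewrite !mul_0, add_0|]. intro IH.
  rewrite !mul_S, IH, <- !add_assoc. f_equal.
  rewrite !add_assoc. f_equal. apply add_comm.
Qed.

Lemma mul_assoc x y z : x * (y * z) = (x * y) * z.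
Proof.
  induct z; [now rewrite !mul_0|]. intro IH.
  now rewrite !mul_S, <- IH, !(mul_comm x), mul_addl.
Qed.

Lemma num_semiring :
  semi_ring_theory 0 1 (add M) (mul M) (@eq N).
Proof.
  constructor; auto using add_0l, add_comm, add_assoc, mul_1l, mul_0l,
    mul_comm, mul_assoc, mul_addl.
Qed.

Add Ring num_ring : num_semiring.

Lemma add_cancel x y z : x + z = y + z -> x = y.
Proof.
  induct z; [now rewrite !add_0|]. intros IH H.
  apply IH, succ_inj. now rewrite <- !add_S.
Qed.

Lemma zero_or_succ x : x = 0 \/ exists y, x = y + 1.
Proof. induct x; eauto. Qed.

Lemma add_eq0 x y : x + y = 0 -> x = 0 /\ y = 0.
Proof.
  destruct (zero_or_succ y) as [->|[y' ->]]; rewrite ?add_0; [auto|].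
  rewrite add_S. intro H; now apply succ_neq0 in H.
Qed.

Lemma mul_neq0 x y : x <> 0 -> y <> 0 -> x * y <> 0.
Proof.
  intros Hx Hy. destruct (zero_or_succ y) as [->|[y' ->]]; [easy|].
  rewrite mul_S. intro H; now apply add_eq0 in H.
Qed.

Lemma lt_iff x y : x < y <-> exists z, y = x + z + 1.
Proof.
  induct y.
  - split; [intro H; now apply lt_0 in H|].
    intros [z H]. now symmetry in H; apply succ_neq0 in H.
  - intro IH. rewrite lt_S, IH. split.
    + intros [[z ->]| ->].
      * exists (z + 1). now rewrite add_S.
      * exists 0. now rewrite add_0.
    + intros [z H]. apply succ_inj in H. subst y.
      destruct (zero_or_succ z) as [->|[z' ->]]; [right; apply eq_sym, add_0|].
      left; exists z'; now rewrite add_S.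
Qed.

Lemma lt_irrefl x : ~ x < x.
Proof.
  rewrite lt_iff; intros [z H]. apply (succ_neq0 z), (add_cancel _ _ x).
  rewrite add_0l. rewrite H at 2. ring.
Qed.

Lemma lt_trans x y z : x < y -> y < z -> x < z.
Proof.
  rewrite !lt_iff; intros [u ->] [v ->]. exists (u + v + 1). ring.
Qed.

Lemma lt_succ x : x < x + 1.
Proof. apply lt_S; auto. Qed.

Lemma lt_add_r x y z : x < y -> x < y + z.
Proof. rewrite !lt_iff; intros [u ->]. exists (u + z). ring. Qed.

Lemma lt_total x y : x < y \/ x = y \/ y < x.
Proof.
  induct x.
  - destruct (zero_or_succ y) as [->|[z ->]]; [auto|left].
    rewrite lt_iff. exists z. now rewrite add_0l.
  - intros [H|[H|H]].
    + apply lt_iff in H; destruct H as [z ->].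
      destruct (zero_or_succ z) as [->|[u ->]].
      * right; left. now rewrite add_0.
      * left. rewrite lt_iff; exists u; ring.
    + right; right. apply lt_S; auto.
    + right; right. apply lt_S; auto.
Qed.

(** Every nonempty arithmetically definable class of numbers has a least
    element. *)
Lemma least (P : N -> Prop) x : defP 1%nat (fun e => P (fst e)) -> P x ->
  exists y, P y /\ forall z, z < y -> ~ P z.
Proof.
  intros HP Hx. apply NNPP; intro H.
  destruct (comprehension P HP) as [X HX].
  assert (K : forall y z, z < y -> ~ z ∈ X).
  { intro y. induct y.
    - intros z Hz; now apply lt_0 in Hz.
    - intros IH z Hz. apply lt_S in Hz. destruct Hz as [Hz| ->]; [auto|].
      rewrite HX. intro Hy. apply H. exists y; split; [exact Hy|].
      intros z Hz; rewrite <- HX; auto. }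
  now apply (K (x + 1) x (lt_succ x)), HX.
Qed.

(** ** Coding of bounded sets *)

Definition divides x y : Prop := exists z, y = x * z.

(** Subtraction of quotients in the absence of negative numbers: if the quotient
    of the sum is smaller than [y], then [x] is zero. *)
Lemma divides_add_cancel d x y : divides d (x + d * y) -> divides d x.
Proof.
  intros [q Hq]. destruct (lt_total q y) as [H|[->|H]].
  - apply lt_iff in H. destruct H as [z ->]. exists 0.
    assert (E : x + (d * (z + 1)) = 0).
    { apply (add_cancel _ _ (d * q)). rewrite add_0l.
      etransitivity; [|exact Hq]. ring. }
    apply add_eq0 in E. rewrite mul_0. apply E.
  - exists 0. apply (add_cancel _ _ (d * y)). rewrite Hq. ring.
  - apply lt_iff in H. destruct H as [z ->]. exists (z + 1).
    apply (add_cancel _ _ (d * y)). rewrite Hq. ring.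
Qed.

(** The moduli of the beta function. *)
Definition modulus v i : N := 1 + (i + 1) * v.

(** If [v] is a multiple of the difference [r + 1] of [i] and [j], then the
    moduli are coprime, by an explicit inverse.  With [d = modulus v i = 1 + p],
    [p = (i + 1) * v] and [v = (r + 1) * w], the other modulus is
    [(r + 1) * v] modulo [d] up to sign; its product with
    [w * (i + 1) * (i + 1)] is [p * p], which is [1] modulo [d] because
    [p * p + d = 1 + p * d]. *)
Lemma modulus_gauss u v i j : i < j \/ j < i ->
  (forall r, i = j + r + 1 \/ j = i + r + 1 -> divides (r + 1) v) ->
  divides (modulus v i) (u * modulus v j) -> divides (modulus v i) u.
Proof.
  intros Hij Hv [q Hq].
  set (d := modulus v i) in *. set (p := (i + 1) * v).
  enough (K : exists x y, d * x = d * y + u * (p * p)).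
  { destruct K as (x & y & K).
    apply divides_add_cancel with (y := u * p + y). exists (x + u).
    transitivity (d * y + u * (p * p) + u * d); [unfold d, modulus, p; ring|].
    rewrite <- K; ring. }
  destruct Hij as [H|H]; apply lt_iff in H; destruct H as [r E];
    (destruct (Hv r) as [w Hw]; [auto|]).
  - exists (q * w * ((i + 1) * (i + 1)) ), (u * w * ((i + 1) * (i + 1))).
    transitivity (d * q * w * ((i + 1) * (i + 1))); [ring|].
    rewrite <- Hq. unfold p.
    transitivity (d * (u * w * ((i + 1) * (i + 1)))
      + u * ((i + 1) * v * ((i + 1) * ((r + 1) * w)))); [|now rewrite <- Hw].
    unfold d, modulus. rewrite E. ring.
  - exists (u * w * ((i + 1) * (i + 1)) ), (q * w * ((i + 1) * (i + 1))).
    transitivity (u * modulus v j * w * ((i + 1) * (i + 1))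
      + u * ((i + 1) * v * ((i + 1) * ((r + 1) * w)))).
    + unfold d, modulus. rewrite E. ring.
    + rewrite Hq, <- Hw. unfold p. ring.
Qed.

Lemma common_multiple k :
  exists v, v <> 0 /\ forall r, r < k -> divides (r + 1) v.
Proof.
  unfold divides. induct k.
  - exists 1; split.
    + (* [1] is the successor of [0]. *)
      rewrite <- (add_0l 1). apply succ_neq0.
    + intros r Hr; now apply lt_0 in Hr.
  - intros (v & Hv & H). exists (v * (k + 1)); split.
    + apply mul_neq0; [exact Hv|apply succ_neq0].
    + intros r Hr. apply lt_S in Hr. destruct Hr as [Hr| ->].
      * destruct (H r Hr) as [z ->]. exists (z * (k + 1)). ring.
      * exists v. ring.
Qed.

(** [i] belongs to the finite set coded by [k], [u] and [v]. *)
Definition coded k u v i : Prop := i < k /\ divides (modulus v i) u.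

(** Every bounded part of a set is coded by numbers: [u] is the product of the
    moduli of its elements. *)
Lemma coding X k : exists u v, forall i, coded k u v i <-> i < k /\ i ∈ X.
Proof.
  destruct (common_multiple k) as (v & Hv & Hdiv).
  assert (Hr : forall i r, i + r + 1 < k -> r < k).
  { intros i r H. apply lt_trans with (i + r + 1); [|exact H].
    rewrite lt_iff. exists i. ring. }
  enough (K : forall j, exists u, forall i, i < k ->
    (divides (modulus v i) u <-> i ∈ X /\ i < j)).
  { destruct (K k) as [u Hu]. exists u, v. intro i.
    unfold coded. specialize (Hu i). tauto. }
  intro j. unfold divides, modulus. induct j.
  - exists 1. intros i Hi; split.
    + (* A modulus divides [1] only if [v] vanishes. *)
      intros [z Hz]. exfalso.
      assert (E : (i + 1) * v = 0).
      { destruct (zero_or_succ z) as [->|[z' ->]].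
        - rewrite mul_0 in Hz. rewrite <- (add_0l 1) in Hz.
          now apply succ_neq0 in Hz.
        - assert (E : (i + 1) * v + z' * (1 + (i + 1) * v) = 0).
          { apply (add_cancel _ _ 1). rewrite add_0l.
            etransitivity; [|symmetry; exact Hz]. ring. }
          apply add_eq0 in E. apply E. }
      revert E. apply mul_neq0; [apply succ_neq0|exact Hv].
    + intros [_ H]. now apply lt_0 in H.
  - intros [u Hu].
    destruct (classic (j ∈ X /\ j < k)) as [[HX Hj]|H].
    + exists (u * (1 + (j + 1) * v)). intros i Hi.
      rewrite lt_S. destruct (classic (i = j)) as [->|Hij].
      * split; [auto|]. intros _. exists u. ring.
      * assert (E : (i < j \/ i = j) <-> i < j) by tauto.
        rewrite E, <- Hu by exact Hi.
        split; [|intros [z ->]; exists (z * (1 + (j + 1) * v)); ring].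
        apply modulus_gauss.
        -- destruct (lt_total i j) as [|[|]]; auto; easy.
        -- intros r [->| ->]; apply Hdiv; eauto.
    + exists u. intros i Hi. rewrite Hu, lt_S by exact Hi.
      split; [tauto|]. intros [HX [Hij| ->]]; [auto|tauto].
Qed.

Definition pairN x y : N := (x + y) * (x + y) + x.

Lemma pairN_inj x y x' y' : pairN x y = pairN x' y' -> x = x' /\ y = y'.
Proof.
  assert (K : forall x y x' y', x + y < x' + y' -> pairN x y <> pairN x' y').
  { intros a b a' b' H E. apply lt_iff in H. destruct H as [z H].
    unfold pairN in E. rewrite H in E.
    apply (succ_neq0 (a + b + b + z + z + (a + b) * (z + z) + z * z + a')).
    apply (add_cancel _ _ ((a + b) * (a + b) + a)). rewrite add_0l.
    etransitivity; [|symmetry; exact E]. ring. }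
  intro E. destruct (lt_total (x + y) (x' + y')) as [H|[H|H]].
  - now apply K in H.
  - unfold pairN in E. rewrite H in E.
    assert (Ex : x = x').
    { apply (add_cancel _ _ ((x' + y') * (x' + y'))).
      rewrite add_comm, E. apply add_comm. }
    split; [exact Ex|]. subst x'. apply (add_cancel _ _ x).
    now rewrite !(add_comm _ x).
  - destruct (K _ _ _ _ H (eq_sym E)).
Qed.

(** Comprehension for binary relations, as sets of codes of pairs. *)
Lemma comprehension2 (P : N -> N -> Prop) :
  defP 2%nat (fun e => P (fst e) (fst (snd e))) ->
  exists X, forall x y, pairN x y ∈ X <-> P x y.
Proof.
  intros (A & HA & HP).
  destruct (comprehension (fun z => exists x y, z = pairN x y /\ P x y))
    as [X HX].
  - apply defP_ex, defP_ex, defP_and; [unfold pairN; definable|].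
    exists (subst (scons (Var 1) (scons (Var 0) (fun n => Var (S (S (S n))))))
      (fun X => X) A).
    split; [now apply arithmetical_subst|].
    intros (y & x & z & e). rewrite sat_subst, <- (HP (x, (y, tt))).
    match goal with |- sat M ?r _ _ <-> sat M ?r' _ _ =>
      replace r with r'; [reflexivity|] end.
    apply functional_extensionality; now intros [|[|n]].
  - exists X. intros x y. rewrite HX. split; [|eauto].
    intros (x' & y' & E & H). apply pairN_inj in E. now destruct E as [-> ->].
Qed.

Lemma coded_insert k u v a :
  exists k' u' v', forall i, coded k' u' v' i <-> coded k u v i \/ i = a.
Proof.
  destruct (comprehension (fun i => coded k u v i \/ i = a)) as [X HX];
    [definable|].
  destruct (coding X (k + (a + 1))) as (u' & v' & H).
  exists (k + (a + 1)), u', v'. intro i. rewrite H, HX.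
  split; [tauto|]. intros [K|K]; (split; [|tauto]).
  - apply lt_add_r, K.
  - subst i. rewrite add_comm. apply lt_add_r, lt_succ.
Qed.

(** ** Dependent choice *)

Section Choice.
Context (F : sets M) (x0 : N).
Context (HF : forall x, exists y, pairN x y ∈ F).

(** Taking least values makes the choice definable and unique. *)
Definition least_image x y : Prop :=
  pairN x y ∈ F /\ forall z, z < y -> ~ pairN x z ∈ F.

Lemma least_image_ex x : exists y, least_image x y.
Proof.
  destruct (HF x) as [y Hy].
  apply (least (fun y => pairN x y ∈ F)) in Hy; [exact Hy|].
  unfold pairN; definable.
Qed.

Lemma least_image_unique x y y' :
  least_image x y -> least_image x y' -> y = y'.
Proof.
  intros [H K] [H' K']. destruct (lt_total y y') as [E|[E|E]]; [|exact E|].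
  - destruct (K' _ E H).
  - destruct (K _ E H').
Qed.

(** The finite set coded by [k], [u] and [v] consists of pairs (index, value)
    that are obtained from the initial pair by steps within the set. *)
Definition computation k u v : Prop :=
  forall n y, coded k u v (pairN n y) ->
    n = 0 /\ y = x0 \/
    exists m x, n = m + 1 /\ coded k u v (pairN m x) /\ least_image x y.

Definition computes n x : Prop :=
  exists k u v, computation k u v /\ coded k u v (pairN n x).

Lemma computes_ex n : exists x, computes n x.
Proof.
  induct n.
  - destruct (coded_insert 0 0 0 (pairN 0 x0)) as (k & u & v & Hk).
    exists x0, k, u, v. split; [|apply Hk; auto].
    intros n y Hy. apply Hk in Hy. destruct Hy as [[Hy _]|Hy].
    + now apply lt_0 in Hy.
    + now apply pairN_inj in Hy; left.
  - intros (x & k & u & v & HC & Hx). destruct (least_image_ex x) as [y Hy].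
    destruct (coded_insert k u v (pairN (n + 1) y)) as (k' & u' & v' & Hk).
    exists y, k', u', v'. split; [|apply Hk; auto].
    intros m z Hz. apply Hk in Hz. destruct Hz as [Hz|Hz].
    + destruct (HC m z Hz) as [H|(m' & z' & E & H & H')]; [auto|right].
      exists m', z'. rewrite Hk; auto.
    + apply pairN_inj in Hz. destruct Hz as [-> ->]. right.
      exists n, x. rewrite Hk; auto.
Qed.

Lemma computes_0 x : computes 0 x -> x = x0.
Proof.
  intros (k & u & v & HC & Hx).
  destruct (HC _ _ Hx) as [[_ H]|(m & _ & H & _)]; [exact H|].
  now symmetry in H; apply succ_neq0 in H.
Qed.

Lemma computes_S n y :
  computes (n + 1) y -> exists x, computes n x /\ least_image x y.
Proof.
  intros (k & u & v & HC & Hx).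
  destruct (HC _ _ Hx) as [[H _]|(m & x & H & Hm & Hxy)].
  - now apply succ_neq0 in H.
  - apply succ_inj in H. subst m. exists x; split; [|exact Hxy].
    now exists k, u, v.
Qed.

Lemma computes_unique n : forall x x', computes n x -> computes n x' -> x = x'.
Proof.
  induct n.
  - intros x x' H H'. apply computes_0 in H, H'. congruence.
  - intros IH y y' H H'.
    apply computes_S in H as (x & H & K), H' as (x' & H' & K').
    rewrite (IH _ _ H H') in K. eapply least_image_unique; eauto.
Qed.

(** The sequence of successive least images is arithmetical because its finite
    initial segments are coded by numbers: a value is correct if it occurs in
    some coded computation. *)
Lemma dependent_choice : exists G : sets M,
  (forall n, exists x, pairN n x ∈ G) /\
  (forall n x x', pairN n x ∈ G -> pairN n x' ∈ G -> x = x') /\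
  (forall x, pairN 0 x ∈ G -> x = x0) /\
  forall n x y, pairN n x ∈ G -> pairN (n + 1) y ∈ G -> pairN x y ∈ F.
Proof.
  destruct (comprehension2 computes) as [G HG]; [definable|].
  exists G. repeat split.
  - intro n. destruct (computes_ex n) as [x Hx]. exists x; now apply HG.
  - intros n x x'. rewrite !HG. apply computes_unique.
  - intros x. rewrite HG. apply computes_0.
  - intros n x y. rewrite !HG. intros H H'.
    apply computes_S in H' as (x' & H' & K).
    rewrite (computes_unique _ _ _ H H'). apply K.
Qed.

End Choice.

(** ** Lattices in the structure *)

Section Lattice.
Context (L R : sets M).

Definition leq x y : Prop := pairN x y ∈ R.
Definition sless x y : Prop := leq x y /\ x <> y.

Definition join_of x y z : Prop :=
  z ∈ L /\ leq x z /\ leq y z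
  /\ forall u, u ∈ L -> leq x u /\ leq y u -> leq z u.

Definition meet_of x y z : Prop :=
  z ∈ L /\ leq z x /\ leq z y
  /\ forall u, u ∈ L -> leq u x /\ leq u y -> leq u z.

Definition included (X Y : sets M) : Prop := forall x, x ∈ X -> x ∈ Y.
Definition bounded_set (X : sets M) : Prop := exists n, forall x, x ∈ X -> x < n.

Definition sup_of X s : Prop :=
  s ∈ L /\ (forall x, x ∈ X -> leq x s)
  /\ forall u, u ∈ L -> (forall x, x ∈ X -> leq x u) -> leq s u.

Definition inf_of X s : Prop :=
  s ∈ L /\ (forall x, x ∈ X -> leq s x)
  /\ forall u, u ∈ L -> (forall x, x ∈ X -> leq u x) -> leq u s.

Definition below_sup X a : Prop := exists s, sup_of X s /\ leq a s.

Definition compact_in a : Prop :=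
  forall X, included X L -> below_sup X a ->
  exists Y, included Y X /\ bounded_set Y /\ below_sup Y a.

Definition coatom b a : Prop :=
  sless b a /\ ~ exists y, y ∈ L /\ sless b y /\ sless y a.

Definition coatomic a : Prop :=
  forall x, x ∈ L -> sless x a -> exists b, b ∈ L /\ leq x b /\ coatom b a.

Record algebraic_distributive : Prop := {
  leq_in : forall x y, leq x y -> x ∈ L /\ y ∈ L;
  leq_refl : forall x, x ∈ L -> leq x x;
  leq_antisym : forall x, x ∈ L -> forall y, y ∈ L ->
    leq x y /\ leq y x -> x = y;
  leq_trans : forall x, x ∈ L -> forall y, y ∈ L -> forall z, z ∈ L ->
    leq x y /\ leq y z -> leq x z;
  join_ex : forall x, x ∈ L -> forall y, y ∈ L -> exists z, join_of x y z;
  meet_ex : forall x, x ∈ L -> forall y, y ∈ L -> exists z, meet_of x y z;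
  distr : forall x, x ∈ L -> forall y, y ∈ L -> forall z, z ∈ L ->
    forall j m p q, join_of y z j /\ meet_of x j m /\ meet_of x y p
      /\ meet_of x z q -> join_of p q m;
  bounds_ex : forall X, included X L ->
    (exists s, sup_of X s) /\ (exists s, inf_of X s);
  generated : forall a, a ∈ L -> exists K, included K L
    /\ (forall c, c ∈ K -> compact_in c) /\ sup_of K a
}.

Context (HL : algebraic_distributive).

Lemma le_trans x y z : leq x y -> leq y z -> leq x z.
Proof.
  intros H K. pose proof (leq_in HL _ _ H). pose proof (leq_in HL _ _ K).
  apply (leq_trans HL x) with (y := y); tauto.
Qed.

Lemma le_antisym x y : leq x y -> leq y x -> x = y.
Proof.
  intros H K. pose proof (leq_in HL _ _ H). apply (leq_antisym HL); tauto.
Qed.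

Section Forward.
Context (a x : N) (Ha : a ∈ L) (Hx : x ∈ L) (Hxa : sless x a).
Context (Hc : compact_in a).

Definition interval y : Prop := leq x y /\ sless y a.

(** Traces, the sets of numbers below an element in the lattice, are compared
    lexicographically; [m] is the first difference. *)
Definition beats z y m : Prop :=
  leq m z /\ ~ leq m y /\ forall k, k < m -> (leq k y <-> leq k z).

Definition best n y : Prop :=
  interval y /\ forall z m, interval z -> m < n -> ~ beats z y m.

(** If some [n]-best element is above [n], it is [n + 1]-best; otherwise every
    [n]-best element is, because an element that first differs from an [n]-best
    one at [n] is itself [n]-best. *)
Lemma best_ex n : exists y, best n y.
Proof.
  induct n.
  - exists x. split; [split; [now apply (leq_refl HL)|exact Hxa]|].
    intros z m _ H. now apply lt_0 in H.
  - intros [y Hy].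
    destruct (classic (exists z, best n z /\ leq n z)) as [(z & Hz & Hn)|H].
    + exists z. split; [apply Hz|]. intros w m Hw Hm. apply lt_S in Hm.
      destruct Hm as [Hm| ->]; [now apply Hz|]. now intros (_ & H & _).
    + exists y. split; [apply Hy|]. intros w m Hw Hm. apply lt_S in Hm.
      destruct Hm as [Hm| ->]; [now apply Hy|]. intros (H1 & H2 & H3).
      apply H. exists w; split; [split; [exact Hw|]|exact H1].
      intros z m Hz Hm (K1 & K2 & K3). apply (proj2 Hy z m Hz Hm).
      split; [exact K1|split].
      * now rewrite (H3 m Hm).
      * intros k Hk. rewrite (H3 k) by (eapply lt_trans; eauto). auto.
Qed.

Lemma trace_difference y z m : (leq m y <-> ~ leq m z) ->
  exists k, (k < m \/ k = m) /\ (beats z y k \/ beats y z k).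
Proof.
  intro H. destruct (least (fun m => leq m y <-> ~ leq m z) m) as (k & Hk & K);
    [definable|exact H|].
  exists k; split.
  - destruct (lt_total k m) as [|[|E]]; auto. now apply K in E.
  - assert (E : forall i, i < k -> (leq i y <-> leq i z)).
    { intros i Hi. specialize (K i Hi). tauto. }
    unfold beats. destruct (classic (leq k z)); [left|right].
    + repeat split; try tauto; now apply E.
    + repeat split; try tauto; now apply E.
Qed.

Lemma best_agree n y z m : best n y -> best n z -> m < n ->
  leq m y -> leq m z.
Proof.
  intros [Iy Hy] [Iz Hz] Hm H. apply NNPP; intro K.
  destruct (trace_difference y z m) as (k & Hk & B); [tauto|].
  assert (Hkn : k < n) by (destruct Hk as [Hk| ->]; eauto using lt_trans).
  destruct B as [B|B]; [now apply (Hy z k)|now apply (Hz y k)].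
Qed.

Lemma best_mono n m y : m < n -> best n y -> best m y.
Proof.
  intros H [Iy Hy]. split; [exact Iy|]. intros z k Iz Hk.
  apply Hy; eauto using lt_trans.
Qed.

Lemma succ_le m n : m < n -> m + 1 < n \/ m + 1 = n.
Proof.
  intro H. destruct (lt_total (m + 1) n) as [K|[K|K]]; auto.
  apply lt_S in K. destruct K as [K| ->]; [|now apply lt_irrefl in H].
  destruct (lt_irrefl m); eauto using lt_trans.
Qed.

(** The coatom is the supremum of the limit [X] of the [n]-best traces.  It is
    below [a] by compactness, since an [n]-best element bounds the part of [X]
    below [n].  An element [y] between it and [a] would lie above all of [X];
    as it does not beat the [y + 1]-best elements, it would have to be in [X]
    itself. *)
Lemma coatom_above : exists b, b ∈ L /\ leq x b /\ coatom b a.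
Proof.
  destruct (comprehension (fun m => exists y, best (m + 1) y /\ leq m y))
    as [X HX]; [definable|].
  assert (Hbest : forall n y m, best n y -> m < n -> (m ∈ X <-> leq m y)).
  { intros n y m Hy Hm.
    assert (Hy' : best (m + 1) y).
    { destruct (succ_le _ _ Hm) as [E|<-]; eauto using best_mono. }
    rewrite HX. split; [|eauto]. intros (z & Hz & K).
    eapply best_agree; [exact Hz|exact Hy'|apply lt_succ|exact K]. }
  assert (HXL : included X L).
  { intros m Hm. apply HX in Hm. destruct Hm as (y & _ & H).
    apply (leq_in HL _ _ H). }
  destruct (bounds_ex HL X HXL) as [[s Hs] _].
  pose proof Hs as (HsL & Hub & Hlub).
  assert (Hxs : leq x s).
  { apply Hub, HX. destruct (best_ex (x + 1)) as [y Hy].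
    exists y; split; [exact Hy|apply Hy]. }
  assert (Hsa : sless s a).
  { split.
    - apply Hlub; [exact Ha|]. intros m Hm. apply HX in Hm.
      destruct Hm as (y & Hy & H). apply le_trans with y; [exact H|apply Hy].
    - intro E. destruct (Hc X HXL) as (Y & HY & [n Hn] & t & Ht & Hat).
      { exists s; split; [exact Hs|]. rewrite E. now apply (leq_refl HL). }
      destruct (best_ex n) as [y Hy]. pose proof Hy as [[Hxy [Hya Hne]] _].
      apply Hne, le_antisym; [exact Hya|]. apply le_trans with t; [exact Hat|].
      apply Ht; [apply (leq_in HL _ _ Hya)|]. intros e He.
      apply (Hbest n y e Hy); auto. }
  exists s. split; [exact HsL|split; [exact Hxs|split; [exact Hsa|]]].
  intros (y & HyL & [Hsy Hne] & Hya). apply Hne, le_antisym; [exact Hsy|].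
  apply Hub. destruct (best_ex (y + 1)) as [z Hz].
  apply (Hbest _ _ _ Hz); [apply lt_succ|]. apply NNPP; intro K.
  destruct (trace_difference y z y) as (k & Hk & B).
  { split; [auto|]. intros _. now apply (leq_refl HL). }
  assert (Hk' : k < y + 1) by now apply lt_S.
  destruct B as [(B & B' & _)|B].
  - apply B'. apply le_trans with s; [|exact Hsy].
    now apply Hub, (Hbest _ _ _ Hz).
  - revert B. apply Hz; [|exact Hk']. split; [|exact Hya].
    now apply le_trans with s.
Qed.

End Forward.

Lemma compact_coatomic a : a ∈ L -> compact_in a -> coatomic a.
Proof. intros Ha Hc x Hx Hxa. now apply coatom_above. Qed.

(** If [v] is not below the coatom [b], then [b] and [v] have join [a], so [u] is
    the join of its meets with [b] and with [v], both of which are below [b]. *)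
Lemma coatom_prime a b u v w : a ∈ L -> b ∈ L -> coatom b a ->
  leq u a -> leq v a -> meet_of u v w -> leq w b -> leq u b \/ leq v b.
Proof.
  intros Ha Hb [[Hba _] Hco] Hu Hv Hw Hwb.
  destruct (classic (leq v b)) as [|Hvb]; [auto|left].
  destruct (leq_in HL _ _ Hu) as [HuL _], (leq_in HL _ _ Hv) as [HvL _].
  destruct (join_ex HL b Hb v HvL) as [j Hj].
  pose proof Hj as (HjL & Hbj & Hvj & Hjl).
  assert (E : j = a).
  { apply NNPP; intro E. apply Hco. exists j.
    split; [exact HjL|split; split; auto]. intros <-; auto. }
  subst j. destruct (meet_ex HL u HuL b Hb) as [p Hp].
  assert (Hm : meet_of u a u).
  { repeat split; auto; [now apply (leq_refl HL)|tauto]. }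
  destruct (distr HL u HuL b Hb v HvL a u p w) as (_ & _ & _ & H); [auto|].
  apply H; [exact Hb|]. split; [apply Hp|exact Hwb].
Qed.

Section Backward.
Context (a : N) (Ha : a ∈ L) (Hco : coatomic a).

Section Part.
Context (K : sets M) (HK : included K L) (HsK : sup_of K a).

Definition bounds n u : Prop := forall k, k ∈ K -> k < n -> leq k u.

Definition coat b : Prop := b ∈ L /\ coatom b a.

Lemma bounds_mono m n u : m < n -> bounds n u -> bounds m u.
Proof. intros H Hu k Hk Hkm. apply Hu; eauto using lt_trans. Qed.

(** Otherwise the coatom would bound all of [K], and [K] has supremum [a]. *)
Lemma coat_not_bound b : coat b -> exists n, ~ bounds n b.
Proof.
  intros [Hb [[Hba Hne] _]]. apply NNPP; intro H.
  apply Hne, le_antisym; [exact Hba|]. apply HsK; [exact Hb|].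
  intros k Hk. apply NNPP; intro E. apply H. exists (k + 1). intro B.
  apply E, B; [exact Hk|apply lt_succ].
Qed.

Lemma coat_eq b c : coat b -> coat c -> leq b c -> b = c.
Proof.
  intros [Hb [_ Hb']] [Hc [Hca _]] H. apply NNPP; intro E.
  apply Hb'. exists c. repeat split; auto; apply Hca.
Qed.

Section Sequence.
Context (Hn : forall n, exists u, u ∈ L /\ bounds n u /\ ~ leq a u).

(** If [u] bounds the part of [K] below [n] but not [a], then so does the meet of
    [u] and [a], which is strictly below [a] and hence below a coatom. *)
Lemma coat_bounding n : exists b, coat b /\ bounds n b.
Proof.
  destruct (Hn n) as (u & HuL & Hu & Hau).
  destruct (meet_ex HL a Ha u HuL) as (x & HxL & Hxa & Hxu & Hx).
  destruct (Hco x HxL) as (b & Hb & Hxb & Hba).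
  { split; [exact Hxa|]. intros ->; auto. }
  exists b. split; [now split|]. intros k Hk Hkn.
  apply le_trans with x; [|exact Hxb]. apply Hx; [auto|].
  split; [now apply HsK|now apply Hu].
Qed.

(** Each coatom is followed by one that bounds a part of [K] which its
    predecessor does not bound.  The parts bounded along the sequence can then
    only grow, so a single part separates a member from all later ones. *)
Lemma separated_coatoms : exists G,
  (forall n, exists b, pairN n b ∈ G) /\
  (forall n b c, pairN n b ∈ G -> pairN n c ∈ G -> b = c) /\
  (forall n b, pairN n b ∈ G -> coat b) /\
  forall i b, pairN i b ∈ G ->
    exists n, ~ bounds n b
      /\ forall j c, i < j -> pairN j c ∈ G -> bounds n c.
Proof.
  destruct (comprehension2 (fun b c => coat b ->
    coat c /\ exists n, ~ bounds n b /\ bounds n c)) as [F HF]; [definable|].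
  destruct (coat_bounding 0) as (b0 & Hb0 & _).
  destruct (dependent_choice F b0) as (G & Gex & Gun & G0 & GS).
  { intro b. destruct (classic (coat b)) as [Hb|Hb].
    - destruct (coat_not_bound b Hb) as [n Hnb].
      destruct (coat_bounding n) as (c & Hc & Hcn).
      exists c. apply HF. eauto.
    - exists 0. apply HF. easy. }
  assert (Gcoat : forall n b, pairN n b ∈ G -> coat b).
  { intro n. unfold coat. induct n.
    - intros b H. now rewrite (G0 b H).
    - intros IH c Hc. destruct (Gex n) as [b Hb].
      apply (proj1 (HF b c) (GS _ _ _ Hb Hc) (IH b Hb)). }
  exists G. split; [exact Gex|split; [exact Gun|split; [exact Gcoat|]]].
  intros i b Hb. destruct (Gex (i + 1)) as [b' Hb'].
  destruct (proj1 (HF b b') (GS _ _ _ Hb Hb') (Gcoat _ _ Hb))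
    as [_ (n & Hnb & Hnb')].
  exists n. split; [exact Hnb|]. intro j. induct j.
  - intros c H. now apply lt_0 in H.
  - intros IH c H Hc. apply lt_S in H. destruct H as [H| ->].
    2: { now rewrite (Gun _ _ _ Hc Hb'). }
    destruct (Gex j) as [d Hd]. specialize (IH d H Hd).
    destruct (proj1 (HF d c) (GS _ _ _ Hd Hc) (Gcoat _ _ Hd))
      as [_ (m & Hmd & Hmc)].
    destruct (lt_total n m) as [E|[->|E]]; [|exact Hmc|].
    + now apply bounds_mono with m.
    + now apply bounds_mono with (m := m) in IH.
Qed.

(** Cantor's diagonal argument: a subset [X] of the sequence is determined by its
    infimum [y], which is a number and hence an index; whether the member [b] of
    the sequence with index [y] is in [X] is decided the wrong way round. *)
Lemma separated_coatoms_absurd : False.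
Proof.
  destruct separated_coatoms as (G & Gex & Gun & Gcoat & Gsep).
  destruct (comprehension (fun b => exists i, pairN i b ∈ G /\ ~ leq i b))
    as [X HX]; [definable|].
  assert (HXL : included X L).
  { intros b Hb. apply HX in Hb. destruct Hb as (i & Hi & _).
    apply (Gcoat i b Hi). }
  destruct (bounds_ex HL X HXL) as [_ (y & HyL & Hlb & Hglb)].
  destruct (Gex y) as [b Hb].
  destruct (classic (leq y b)) as [Hyb|Hyb].
  2: { apply Hyb, Hlb, HX. eauto. }
  assert (HbX : ~ b ∈ X).
  { rewrite HX. intros (i & Hi & Hib).
    destruct (lt_total i y) as [E|[->|E]]; [|auto|].
    - destruct (Gsep i b Hi) as (n & H & K'). apply H. eauto.
    - destruct (Gsep y b Hb) as (n & H & K'). apply H. eauto. }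
  destruct (Gsep y b Hb) as (m & Hm & Hlater).
  (* A lower bound [w] of [X] that is not below [b] gives a contradiction.  It is
     an element of [K] that is not below [b] but below the later members, met
     with the earlier members. *)
  assert (Hk : exists k, k ∈ K /\ k < m /\ ~ leq k b).
  { apply NNPP; intro H. apply Hm. intros k Hk Hkm.
    apply NNPP; intro E. apply H. exists k; auto. }
  destruct Hk as (k & HkK & Hkm & Hkb).
  assert (Hw : forall n, exists w, w ∈ L /\ leq w a /\ ~ leq w b /\
    forall j c, pairN j c ∈ G -> c ∈ X -> j < n \/ y < j -> leq w c).
  { intro n. induct n.
    - exists k. split; [auto|split; [now apply HsK|split; [exact Hkb|]]].
      intros j c Hjc _ [H|H]; [now apply lt_0 in H|].
      now apply (Hlater j c).
    - intros (w & HwL & Hwa & Hwb & Hw). destruct (Gex n) as [d Hd].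
      pose proof (Gcoat n d Hd) as Hdc.
      destruct (classic (d ∈ X)) as [HdX|HdX].
      + destruct (meet_ex HL w HwL d (proj1 Hdc)) as [v Hv].
        pose proof Hv as (HvL & Hvw & Hvd & _).
        exists v. split; [exact HvL|split; [now apply le_trans with w|split]].
        * intro Hvb. destruct (Gcoat y b Hb) as [HbL Hba].
          destruct (coatom_prime a b w d v Ha HbL Hba Hwa) as [E|E]; auto.
          -- apply Hdc.
          -- apply coat_eq in E; [congruence|exact Hdc|now split].
        * intros j c Hjc HcX H. rewrite lt_S in H.
          destruct H as [[H|E]|H].
          -- apply le_trans with w; eauto.
          -- subst j. now rewrite (Gun _ _ _ Hjc Hd).
          -- apply le_trans with w; eauto.
      + exists w. repeat split; auto. intros j c Hjc HcX H.
        rewrite lt_S in H. destruct H as [[H|E]|H]; eauto.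
        subst j. now rewrite (Gun _ _ _ Hjc Hd) in HcX. }
  destruct (Hw y) as (w & HwL & Hwa & Hwb & Hwc).
  apply Hwb. apply le_trans with y; [|exact Hyb].
  apply Hglb; [exact HwL|]. intros c Hc. pose proof Hc as Hc'.
  apply HX in Hc'. destruct Hc' as (j & Hj & _).
  apply (Hwc j c Hj Hc). destruct (lt_total j y) as [E|[->|E]]; auto.
  now rewrite (Gun _ _ _ Hj Hb) in Hc.
Qed.

End Sequence.

(** [K] has a finite part with supremum [a]; speaking about all upper bounds
    avoids introducing the supremum. *)
Lemma bounded_part : exists n, forall u, u ∈ L -> bounds n u -> leq a u.
Proof.
  apply NNPP; intro H. apply separated_coatoms_absurd. intro n.
  apply NNPP; intro H'. apply H. exists n. intros u Hu Hb.
  apply NNPP; intro Hau. apply H'. eauto.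
Qed.

(** A finite join of compact elements is compact.  The finite subsets of [X]
    found for the members of [K] are replaced by initial parts of [X], for which
    a common number [p] suffices. *)
Lemma compact_of_part n : (forall k, k ∈ K -> compact_in k) ->
  (forall u, u ∈ L -> bounds n u -> leq a u) -> compact_in a.
Proof.
  intros HKc Hn X HX (s & Hs & Has).
  assert (Hfin : forall m, exists p, forall k, k ∈ K -> k < m ->
    forall u, u ∈ L -> (forall x, x ∈ X -> x < p -> leq x u) -> leq k u).
  { intro m. induct m.
    - exists 0. intros k _ H. now apply lt_0 in H.
    - intros [p Hp].
      destruct (classic (m ∈ K)) as [Hm|Hm].
      + destruct (HKc m Hm X HX) as (Y & HYX & [q Hq] & t & Ht & Hmt).
        { exists s; split; [exact Hs|]. apply le_trans with a; [|exact Has].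
          now apply HsK. }
        exists (p + q). intros k Hk Hkm u Hu Hub. apply lt_S in Hkm.
        destruct Hkm as [Hkm| ->].
        * apply (Hp k Hk Hkm u Hu). intros x Hx Hxp.
          apply Hub; [exact Hx|now apply lt_add_r].
        * apply le_trans with t; [exact Hmt|]. apply Ht; [exact Hu|].
          intros x Hx. apply Hub; [now apply HYX|].
          rewrite add_comm. apply lt_add_r; auto.
      + exists p. intros k Hk Hkm. apply lt_S in Hkm.
        destruct Hkm as [Hkm| ->]; [auto|easy]. }
  destruct (Hfin n) as [p Hp].
  destruct (comprehension (fun x => x ∈ X /\ x < p)) as [Y HY]; [definable|].
  assert (HYX : included Y X) by (intros x Hx; now apply HY).
  destruct (bounds_ex HL Y) as [[t Ht] _]; [intros x Hx; auto|].
  exists Y. split; [exact HYX|split; [exists p; intros x Hx; now apply HY|]].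
  exists t; split; [exact Ht|]. apply Hn; [apply Ht|].
  intros k Hk Hkn. apply (Hp k Hk Hkn); [apply Ht|].
  intros x Hx Hxp. apply Ht, HY. auto.
Qed.

End Part.

Lemma coatomic_compact : compact_in a.
Proof.
  destruct (generated HL a Ha) as (K & HK & HKc & HsK).
  destruct (bounded_part K HK HsK) as [n Hn].
  now apply (compact_of_part K HsK n).
Qed.

End Backward.

End Lattice.

End Model.

(** * Meaning of the formulas on lattices *)

Section Meaning.
Context (M : structure).
Implicit Types (rho : nat -> num M) (sigma : nat -> sets M).

Lemma means_And rho sigma A B P Q :
  (sat M rho sigma A <-> P) -> (sat M rho sigma B <-> Q) ->
  (sat M rho sigma (A ∧ B) <-> P /\ Q).
Proof. rewrite sat_And; tauto. Qed.

Lemma means_Iff rho sigma A B P Q :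
  (sat M rho sigma A <-> P) -> (sat M rho sigma B <-> Q) ->
  (sat M rho sigma (A ⇔ B) <-> (P <-> Q)).
Proof. rewrite sat_Iff; tauto. Qed.

Lemma means_Imp rho sigma A B (P Q : Prop) :
  (sat M rho sigma A <-> P) -> (sat M rho sigma B <-> Q) ->
  (sat M rho sigma (A ⇒ B) <-> (P -> Q)).
Proof. cbn; tauto. Qed.

Lemma means_Not rho sigma A P :
  (sat M rho sigma A <-> P) -> (sat M rho sigma (Not A) <-> ~ P).
Proof. cbn; tauto. Qed.

Lemma means_AllN rho sigma A (P : num M -> Prop) :
  (forall x, sat M (scons x rho) sigma A <-> P x) ->
  (sat M rho sigma (AllN A) <-> forall x, P x).
Proof. cbn; firstorder. Qed.

Lemma means_ExN rho sigma A (P : num M -> Prop) :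
  (forall x, sat M (scons x rho) sigma A <-> P x) ->
  (sat M rho sigma (ExN A) <-> exists x, P x).
Proof. rewrite sat_ExN; firstorder. Qed.

Lemma means_AllS rho sigma A (P : sets M -> Prop) :
  (forall X, sat M rho (scons X sigma) A <-> P X) ->
  (sat M rho sigma (AllS A) <-> forall X, P X).
Proof. cbn; firstorder. Qed.

Lemma means_ExS rho sigma A (P : sets M -> Prop) :
  (forall X, sat M rho (scons X sigma) A <-> P X) ->
  (sat M rho sigma (ExS A) <-> exists X, P X).
Proof. rewrite sat_ExS; firstorder. Qed.

Lemma means_allIn rho sigma X A (P : num M -> Prop) :
  (forall x, sat M (scons x rho) sigma A <-> P x) ->
  (sat M rho sigma (allIn X A) <-> forall x, mem M x (sigma X) -> P x).
Proof. cbn; firstorder. Qed.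

Lemma means_exIn rho sigma X A (P : num M -> Prop) :
  (forall x, sat M (scons x rho) sigma A <-> P x) ->
  (sat M rho sigma (exIn X A) <-> exists x, mem M x (sigma X) /\ P x).
Proof.
  intro H. unfold exIn. apply means_ExN. intro x.
  apply means_And; [reflexivity|apply H].
Qed.

Lemma means_le rho sigma R s t x y : eval M rho s = x -> eval M rho t = y ->
  (sat M rho sigma (le R s t) <-> leq M (sigma R) x y).
Proof. intros <- <-. reflexivity. Qed.

Lemma means_lt rho sigma R s t x y : eval M rho s = x -> eval M rho t = y ->
  (sat M rho sigma (lt R s t) <-> sless M (sigma R) x y).
Proof.
  intros <- <-. apply means_And; [reflexivity|]. apply means_Not. reflexivity.
Qed.

End Meaning.

(** Matching on the syntactic head keeps conjunctions and the like, which are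
    themselves implications, from being taken apart too far. *)
Ltac meaning := repeat
  lazymatch goal with
  | |- sat _ _ _ (allIn _ _) <-> _ => apply means_allIn; intro
  | |- sat _ _ _ (exIn _ _) <-> _ => apply means_exIn; intro
  | |- sat _ _ _ (And _ _) <-> _ => apply means_And
  | |- sat _ _ _ (Iff _ _) <-> _ => apply means_Iff
  | |- sat _ _ _ (Imp _ _) <-> _ => apply means_Imp
  | |- sat _ _ _ (Not _) <-> _ => apply means_Not
  | |- sat _ _ _ (AllN _) <-> _ => apply means_AllN; intro
  | |- sat _ _ _ (ExN _) <-> _ => apply means_ExN; intro
  | |- sat _ _ _ (AllS _) <-> _ => apply means_AllS; intro
  | |- sat _ _ _ (ExS _) <-> _ => apply means_ExS; intro
  | |- sat _ _ _ (In _ _) <-> _ => reflexivity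
  | |- sat _ _ _ (Eq _ _) <-> _ => reflexivity
  | |- sat _ _ _ (Lt _ _) <-> _ => reflexivity
  | |- sat _ _ _ (le _ _ _) <-> _ =>
      apply means_le; rewrite ?eval_liftT; reflexivity
  | |- sat _ _ _ (lt _ _ _) <-> _ =>
      apply means_lt; rewrite ?eval_liftT; reflexivity
  end.

Section LatticeMeaning.
Context (M : structure).
Implicit Types (rho : nat -> num M) (sigma : nat -> sets M).

Lemma sat_is_sup rho sigma L R X s :
  sat M rho sigma (is_sup L R X s)
  <-> sup_of M (sigma L) (sigma R) (sigma X) (eval M rho s).
Proof. unfold is_sup, sup_of. meaning. Qed.

Lemma sat_is_inf rho sigma L R X s :
  sat M rho sigma (is_inf L R X s)
  <-> inf_of M (sigma L) (sigma R) (sigma X) (eval M rho s).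
Proof. unfold is_inf, inf_of. meaning. Qed.

Lemma sat_is_join rho sigma L R s t u :
  sat M rho sigma (is_join L R s t u)
  <-> join_of M (sigma L) (sigma R) (eval M rho s) (eval M rho t) (eval M rho u).
Proof. unfold is_join, join_of. meaning. Qed.

Lemma sat_is_meet rho sigma L R s t u :
  sat M rho sigma (is_meet L R s t u)
  <-> meet_of M (sigma L) (sigma R) (eval M rho s) (eval M rho t) (eval M rho u).
Proof. unfold is_meet, meet_of. meaning. Qed.

Lemma sat_le_sup rho sigma L R X s :
  sat M rho sigma (le_sup L R X s)
  <-> below_sup M (sigma L) (sigma R) (sigma X) (eval M rho s).
Proof. unfold le_sup, below_sup. meaning. apply sat_is_sup. Qed.

Lemma sat_compact rho sigma L R s :
  sat M rho sigma (compact L R s)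
  <-> compact_in M (sigma L) (sigma R) (eval M rho s).
Proof.
  unfold compact, compact_in, subset, finite. meaning; apply sat_le_sup.
Qed.

Lemma sat_coatom rho sigma L R s t :
  sat M rho sigma (coatom_below L R s t)
  <-> coatom M (sigma L) (sigma R) (eval M rho s) (eval M rho t).
Proof. unfold coatom_below, coatom. meaning. Qed.

Lemma sat_coatomic rho sigma L R s :
  sat M rho sigma (coatomic_below L R s)
  <-> coatomic M (sigma L) (sigma R) (eval M rho s).
Proof.
  unfold coatomic_below, coatomic. meaning.
  rewrite sat_coatom, !eval_liftT. reflexivity.
Qed.

Lemma sat_algebraic_distributive rho sigma L R :
  sat M rho sigma (lattice L R ∧ algebraic L R ∧ distributive L R)%soa ->
  algebraic_distributive M (sigma L) (sigma R).
Proof.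
  eassert (E : sat M rho sigma
    (lattice L R ∧ algebraic L R ∧ distributive L R)%soa <-> _).
  { unfold lattice, partial_order, algebraic, complete, compactly_generated,
      distributive, subset.
    meaning; first [apply sat_is_join | apply sat_is_meet | apply sat_is_sup
      | apply sat_is_inf | apply sat_compact]. }
  rewrite E. cbn [eval scons].
  intros (((H1 & H2 & H3 & H4) & H5 & H6) & (H7 & H8) & H9).
  constructor; assumption.
Qed.

End LatticeMeaning.

(** * The theorem *)

(** The prenex form of the condition on [#0]; in the matrix, the element, the
    given element below it, the coatom and the element that is not strictly in
    between are [#3], [#2], [#1] and [#0]. *)
Definition coatomic_matrix : form :=
  #3 ∈ 1 ∧ (#2 ∈ 1 ⇒ lt 0 #2 #3 ⇒
    #1 ∈ 1 ∧ le 0 #2 #1 ∧ lt 0 #1 #3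
    ∧ Not (#0 ∈ 1 ∧ lt 0 #1 #0 ∧ lt 0 #0 #3)).

Definition coatomic_prenex : form := AllN (ExN (AllN coatomic_matrix)).

Lemma coatomic_prenex_Pi03 : Pi03 coatomic_prenex.
Proof.
  exists coatomic_matrix. split; [|reflexivity].
  repeat constructor.
Qed.

Lemma sat_coatomic_prenex M rho sigma :
  sat M rho sigma (#0 ∈ 1 ∧ coatomic_below 1 0 #0)
  <-> sat M rho sigma coatomic_prenex.
Proof.
  eassert (E : sat M rho sigma coatomic_prenex <-> _)
    by (unfold coatomic_prenex, coatomic_matrix; meaning).
  rewrite sat_And, sat_coatomic, E. cbn [eval scons].
  set (a := rho 0). set (L := sigma 1). set (R := sigma 0).
  split.
  - intros [Ha Hco] x.
    destruct (classic (mem M x L /\ sless M R x a)) as [[Hx Hxa]|Hx].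
    + destruct (Hco x Hx Hxa) as (b & Hb & Hxb & Hba & H).
      exists b. intro y. split; [exact Ha|]. intros _ _.
      repeat split; auto; try apply Hba.
      intro Hy. apply H. now exists y.
    + (* If [x] is not an element below [a], any number will do. *)
      exists a. intro y. split; [exact Ha|]. intros. destruct Hx; now split.
  - intro H. split.
    + destruct (H a) as [b Hb]. apply (Hb a).
    + intros x Hx Hxa. destruct (H x) as [b Hb]. exists b.
      pose proof (proj2 (Hb a) Hx Hxa) as (HbL & Hxb & Hba & _).
      repeat split; auto; try apply Hba.
      intros [y Hy]. now apply (proj2 (Hb y) Hx Hxa).
Qed.

(* Below the two quantifiers [AllS (AllS _)] the lattice is (L, ≤) = (1, 0). *)
Theorem theorem5p3 :
  provable ACA0
    (AllS (AllS (lattice 1 0 ∧ algebraic 1 0 ∧ distributive 1 0 ⇒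
       allIn 1 (compact 1 0 #0 ⇔ coatomic_below 1 0 #0))))
  /\
  exists P : form,
    Pi03 P /\ vars_below 1 2 P /\
    provable ACA0
      (AllS (AllS (lattice 1 0 ∧ algebraic 1 0 ∧ distributive 1 0 ⇒
         AllN (#0 ∈ 1 ∧ coatomic_below 1 0 #0 ⇔ P)))).
Proof.
  split.
  - apply (completeness ACA0 ACA0_subst_closed).
    intros M [name Hname] [sname Hsname] HM rho sigma L R HL a Ha.
    apply sat_algebraic_distributive in HL.
    rewrite sat_Iff, sat_compact, sat_coatomic.
    split.
    + now apply (compact_coatomic M HM name Hname sname Hsname).
    + now apply (coatomic_compact M HM name Hname sname Hsname).
  - exists coatomic_prenex. split; [apply coatomic_prenex_Pi03|split].
    + cbn. repeat split; auto with arith.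
    + apply (completeness ACA0 ACA0_subst_closed).
      intros M _ _ _ rho sigma L R _ a.
      rewrite sat_Iff. apply sat_coatomic_prenex.
Qed.
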